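(* Let $\{X_n, n \in \mathbb{N}\}$ be a sequence of orthogonally invariant, i.i.d. random matrices in $\mathcal{P}_m$ such that $\mathbb{E}(X_n) = I_m$ for all $n$. Let $S_1 = X_1$, $S_{j+1} = S_j^{1/2} X_{j+1} S_j^{1/2}$ for $j \ge 1$, and for $n \ge 1$ let $M_n = \max_{1 \le j \le n} d_R(I_m, X_j)$ and $U_n = \max_{1 \le j \le n} d_R(I_m, S_j)$. Then the sequence $\{S_n, n \in \mathbb{N}\}$ is a martingale, and the sequences $\{M_n, n \in \mathbb{N}\}$ and $\{U_n, n \in \mathbb{N}\}$ are submartingales.
   Context: $\mathcal{P}_m$ is the cone of real symmetric positive definite $m \times m$ matrices, $I_m$ is the identity matrix, and $A^{1/2}$ is the positive definite square root of $A \in \mathcal{P}_m$. A random matrix $X \in \mathcal{P}_m$ is orthogonally invariant if $X$ and $kXk'$ have the same distribution for every $k$ in the orthogonal group $O(m)$. The Riemannian metric on $\mathcal{P}_m$ is $d_R(A,B) = \big(\sum_{j=1}^m [\log \lambda_j(A^{-1/2} B A^{-1/2})]^2\big)^{1/2}$, where $\lambda_j(\cdot)$ denote eigenvalues. A sequence $\{Y_n, n \in \mathbb{N}\}$ of random elements of a finite-dimensional normed space (here the symmetric $m\times m$ matrices with the spectral norm) with $\mathbb{E}(\|Y_n\|) < \infty$ is a martingale if $Y_n = \mathbb{E}(Y_{n+1} \mid Y_1, \ldots, Y_n)$ for all $n \ge 1$; a scalar sequence with $\mathbb{E}|Y_n| < \infty$ is a submartingale if $Y_n \le \mathbb{E}(Y_{n+1}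 \mid Y_1, \ldots, Y_n)$ for all $n \ge 1$.
   Formalization: M_n and U_n are shown to be submartingales with finite means only if E d_R(I_m, X_1) < ∞, which is necessary and can fail (m = 1, E|log X_1| = ∞); without it, only the submartingale inequality with possibly infinite conditional expectations is shown. *)

(* Defs.v *)
From HB Require Import structures.
From mathcomp Require Import all_boot all_order all_algebra finmap.
From mathcomp Require Import all_classical all_reals all_analysis.
From mathcomp Require Import measurable_realfun.
Set Implicit Arguments.
Unset Strict Implicit.
Unset Printing Implicit Defensive.
Import Order.TTheory GRing.Theory Num.Theory.
Import numFieldNormedType.Exports.

Local Open Scope classical_set_scope.
Local Open Scope ring_scope.

(* Coordinates generate the Borel sigma-algebra of the finite-dimensional
   space of matrices; this mirrors the library's instance on n.-tuple T. *)
Definition measure_mx_display : measure_display -> measure_display.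
Proof. exact. Qed.

Section measurable_mx.
Context {d : measure_display} {T : measurableType d} (m n : nat).

Definition g_sigma_coord : set (set 'M[T]_(m, n)) :=
  <<s \bigcup_(ij in [set: 'I_m * 'I_n])
        preimage_set_system setT (fun A : 'M[T]_(m, n) => A ij.1 ij.2)
          measurable >>.

Let mx_set0 : g_sigma_coord set0.
Proof. exact: sigma_algebra0. Qed.

Let mx_setC A : g_sigma_coord A -> g_sigma_coord (~` A).
Proof. exact: sigma_algebraC. Qed.

Let mx_bigcup (F : (set 'M[T]_(m, n))^nat) :
  (forall i, g_sigma_coord (F i)) -> g_sigma_coord (\bigcup_i F i).
Proof. exact: sigma_algebra_bigcup. Qed.

HB.instance Definition _ := @isMeasurable.Build (measure_mx_display d)
  'M[T]_(m, n) g_sigma_coord mx_set0 mx_setC mx_bigcup.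

End measurable_mx.

Section matrices.
Context {R : realType}.

Definition posdefmx m (A : 'M[R]_m) : Prop :=
  A \is symmetricmx /\
  forall v : 'cV[R]_m, v != 0 -> 0 < (v^T *m A *m v) 0 0.

Definition orthogonalmx m (k : 'M[R]_m) : Prop := k *m k^T = 1%:M.

(* A^{1/2} for A positive definite; 0 is a dummy value when no root exists. *)
Definition sqrtmx m (A : 'M[R]_m) : 'M[R]_m :=
  xget 0 [set B | posdefmx B /\ B *m B = A].

(* The eigenvalues with multiplicity, in some order, when the characteristic
   polynomial splits over R (in particular for symmetric A); else empty. *)
Definition eigvals m (A : 'M[R]_m) : seq R :=
  xget [::] [set s | char_poly A = \prod_(x <- s) ('X - x%:P)].

Definition dR m (A B : 'M[R]_m) : R :=
  let C := invmx (sqrtmx A) *m B *m invmx (sqrtmx A) in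
  Num.sqrt (\sum_(x <- eigvals C) ln x ^+ 2).

Definition enorm m (v : 'cV[R]_m) : R := Num.sqrt (\sum_i v i 0 ^+ 2).

Definition specnorm m (A : 'M[R]_m) : R :=
  sup [set enorm (A *m v) | v in [set v | enorm v <= 1]].

End matrices.

Section probability.
Context {d : measure_display} {T : measurableType d} {R : realType}.
Variable P : probability T R.

Definition same_distribution {d' : measure_display} {E : measurableType d'}
    (X Y : T -> E) : Prop :=
  forall B, measurable B -> P (X @^-1` B) = P (Y @^-1` B).

Definition mutually_independent {d' : measure_display}
    {E : measurableType d'} (X : nat -> T -> E) : Prop :=
  forall (J : {fset nat}) (B : nat -> set E), (forall j, measurable (B j)) ->
    P (\bigcap_(j in [set` J]) X j @^-1` B j)
    = (\prod_(j <- J) P (X j @^-1` B j))%E.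

Definition orthogonally_invariant m (X : T -> 'M[R]_m) : Prop :=
  forall k : 'M[R]_m, orthogonalmx k ->
    same_distribution X (fun w => k *m X w *m k^T).

Definition has_mean_mx m (X : T -> 'M[R]_m) (A : 'M[R]_m) : Prop :=
  forall i j, P.-integrable setT (fun w => (X w i j)%:E) /\
    ('E_P[fun w => X w i j] = (A i j)%:E)%E.

(* The sigma-algebra generated by Y 0, ..., Y n. *)
Definition history {d' : measure_display} {E : measurableType d'}
    (Y : nat -> T -> E) (n : nat) : set (set T) :=
  g_sigma_preimage (fun i : 'I_n.+1 => Y i).

(* Z is a version of E(Y | G), for G a sub-sigma-algebra.  This is meant for Y
   integrable, or nonnegative with a possibly infinite mean; the integral
   identity then forces Z to be integrable, resp. nonnegative, up to a null
   set. *)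
Definition cond_mean (G : set (set T)) (Y Z : T -> \bar R) : Prop :=
  preimage_set_system setT Z measurable `<=` G /\
  forall A, G A -> (\int[P]_(w in A) Z w = \int[P]_(w in A) Y w)%E.

(* The conditional expectation of a random matrix is taken entrywise. *)
Definition cond_mean_mx m (G : set (set T)) (Y Z : T -> 'M[R]_m) : Prop :=
  forall i j, cond_mean G (fun w => (Y w i j)%:E) (fun w => (Z w i j)%:E).

Definition martingale_mx m (Y : nat -> T -> 'M[R]_m) : Prop :=
  [/\ forall n w, Y n w \is symmetricmx,
      forall n, measurable_fun setT (Y n),
      forall n, P.-integrable setT (fun w => (specnorm (Y n w))%:E) &
      forall n, exists2 Z, cond_mean_mx (history Y n) (Y n.+1) Z &
        {ae P, forall w, Y n w = Z w}].

Definition submartingale_ineq (Y : nat -> T -> R) : Prop :=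
  forall n, exists2 Z,
    cond_mean (history Y n) (fun w => (Y n.+1 w)%:E) Z &
    {ae P, forall w, ((Y n w)%:E <= Z w)%E}.

Definition submartingale (Y : nat -> T -> R) : Prop :=
  (forall n, P.-integrable setT (fun w => (Y n w)%:E)) /\
  submartingale_ineq Y.

(* Submartingale of nonnegative variables whose means may be infinite. *)
Definition ge0_submartingale (Y : nat -> T -> R) : Prop :=
  [/\ forall n w, 0 <= Y n w, forall n, measurable_fun setT (Y n) &
      submartingale_ineq Y].

(* Indices are shifted by one: X 0, X 1, ... stand for X_1, X_2, ...,
   and likewise for the three sequences below. *)
Fixpoint Sseq m (X : nat -> T -> 'M[R]_m) (n : nat) (w : T) : 'M[R]_m :=
  if n is j.+1 then
    sqrtmx (Sseq X j w) *m X j.+1 w *m sqrtmx (Sseq X j w)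
  else X 0%N w.

Definition Mseq m (X : nat -> T -> 'M[R]_m) (n : nat) (w : T) : R :=
  \big[Num.max/0]_(j < n.+1) dR 1%:M (X j w).

Definition Useq m (X : nat -> T -> 'M[R]_m) (n : nat) (w : T) : R :=
  \big[Num.max/0]_(j < n.+1) dR 1%:M (Sseq X j w).

End probability.

(* Main.v *)
(* The running maxima M_n and U_n are nondecreasing in n, so they are
   submartingales as soon as their nonnegative increments have conditional
   means; these come from the Radon-Nikodym theorem, applied to the bounded
   pieces obtained by cutting an increment into the slices k <= . < k + 1.
   The sequence S_n is a martingale because S_n^{1/2} is a function of
   X_1, ..., X_n, which are independent of X_{n+1}, and E(X_{n+1}) = I_m; the
   entries of S_n^{1/2} are square integrable since their squares are bounded by
   the diagonal entries of S_n.  For the integrability of U_n, instead of the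
   triangle inequality for d_R, comparing quadratic forms gives
   d_R(I, S_{n+1}) <= m (d_R(I, S_n) + d_R(I, X_{n+1})).  The measurability of
   A^{1/2} and d_R(I, A) is obtained by writing them as limits of polynomials in
   A, resp. in the iterated square roots of A, using the spectral theorem. *)
Require Import Defs.
From HB Require Import structures.
From mathcomp Require Import all_boot all_order all_algebra finmap.
From mathcomp Require Import all_classical all_reals all_analysis.
From mathcomp Require Import measurable_realfun ring lra.
From mathcomp Require complex.
Set Implicit Arguments.
Unset Strict Implicit.
Unset Printing Implicit Defensive.
Import Order.TTheory GRing.Theory Num.Theory.
Import numFieldNormedType.Exports.
Local Open Scope classical_set_scope.
Local Open Scope ring_scope.

(** * Real spectral theorem *)

Lemma symmetricmxP (F : fieldType) n (A : 'M[F]_n) :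
  reflect (A^T = A) (A \is symmetricmx).
Proof.
apply: (iffP (is_hermitianmxP _ _ _)); rewrite expr0 scale1r map_mx_id// => ->;
  by rewrite ?trmxK.
Qed.

Section complexification.
Import complex.

(** Complexification turns [A] into a hermitian matrix, whose spectral diagonal is real. A row of
    the diagonalizing matrix is an eigenvector for a real value, and being an eigenvalue descends
    from [R[i]] to [R]. *)
Lemma symmetric_eigenvalue (R : realType) n (A : 'M[R]_n.+1) :
  A^T = A -> exists a, eigenvalue A a.
Proof.
move=> symA; pose f := @real_complex R.
have hA : map_mx f A \is hermsymmx.
  apply: realsym_hermsym.
    by apply/symmetricmxP/matrixP => i j; rewrite !mxE -[in RHS]symA mxE.
  by apply/mxOverP => i j; rewrite !mxE complex_real.
have /mxOverP/(_ 0 0) := hermitian_spectral_diag_real hA.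
have /hermitian_normalmx/orthomx_spectralP := hA.
set p := spectralmx _; set s := spectral_diag _ => Aps s0r.
have [a sa] : exists a, s 0 0 = f a.
  by exists (Re (s 0 0)); rewrite /f/= RRe_real.
suff : eigenvalue (map_mx f A) (f a) by rewrite eigenvalue_map; exists a.
rewrite -sa; apply/eigenvalueP.
have pu : p \in unitmx by exact: spectral_unit.
exists (row 0 p); last first.
  apply/eqP => p0; move: pu; rewrite unitmxE (expand_det_row _ 0) big1 ?unitr0//.
  by move=> j _; move/rowP/(_ j): p0; rewrite !mxE => ->; rewrite mul0r.
rewrite Aps -row_mul -mulmxA mulKVmx// row_mul row_diag_mx -scalemxAl.
by rewrite -rowE.
Qed.

End complexification.

Section spectral.
Context {R : realType}.

Lemma row_normsq_ge0 n (v : 'rV[R]_n) : 0 <= (v *m v^T) 0 0.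
Proof.
by rewrite mxE sumr_ge0// => i _; rewrite mxE -expr2 sqr_ge0.
Qed.

Lemma row_normsq_gt0 n (v : 'rV[R]_n) : v != 0 -> 0 < (v *m v^T) 0 0.
Proof.
rewrite lt_neqAle row_normsq_ge0 andbT; apply: contra_neq => /esym/eqP.
rewrite mxE psumr_eq0 => [|i _]; last by rewrite mxE -expr2 sqr_ge0.
move=> /allP v0; apply/rowP => i; apply/eqP.
by have := v0 i; rewrite mem_index_enum !mxE mulf_eq0 orbb; apply.
Qed.

(* H is the Householder reflection exchanging the first basis vector and u. *)
Lemma unit_row_complete n (u : 'rV[R]_n.+1) : u *m u^T = 1%:M ->
  exists2 H : 'M[R]_n.+1, H *m H^T = 1%:M & delta_mx 0 0 *m H = u.
Proof.
move=> u1; pose e : 'rV[R]_n.+1 := delta_mx 0 0.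
have [<-|eu] := eqVneq e u; first by exists 1%:M; rewrite ?trmx1 ?mulmx1.
pose w := u - e; have w0 : w != 0 by rewrite subr_eq0 eq_sym.
pose c := (w *m w^T) 0 0; have c0 : c != 0 by rewrite gt_eqF// row_normsq_gt0.
have wc : w *m w^T = c%:M by rewrite [LHS]mx11_scalar.
have ee : e *m e^T = 1%:M.
  by rewrite trmx_delta mul_delta_mx; apply/matrixP => i j; rewrite !ord1 !mxE.
pose p := (e *m u^T) 0 0.
have euE : e *m u^T = p%:M by rewrite [LHS]mx11_scalar.
have ueE : u *m e^T = p%:M by rewrite -[LHS]trmxK trmx_mul trmxK euE tr_scalar_mx.
(* As [u] and [e] are unit vectors, the component of [e] along [w] is [- w / 2]; reversing it moves
   [e] to [e + w = u]. *)
have ewE : e *m w^T = (- (c / 2))%:M.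
  have -> : c = 2 - 2 * p.
    by rewrite /c /w linearB/= mulmxBl !mulmxBr u1 ee euE ueE !mxE/=; ring.
  by rewrite /w linearB/= mulmxBr ee euE -raddfB/=; congr _%:M; field.
pose H := 1%:M - (2 / c) *: (w^T *m w).
have HT : H^T = H by rewrite /H linearB/= linearZ/= trmx1 trmx_mul trmxK.
exists H; last first.
  rewrite mulmxBr mulmx1 -scalemxAr mulmxA ewE mul_scalar_mx scalerA.
  have -> : 2 / c * - (c / 2) = -1 :> R by field.
  by rewrite scaleN1r opprK /w addrC subrK.
have wwE : (w^T *m w) *m (w^T *m w) = c *: (w^T *m w).
  by rewrite mulmxA -(mulmxA w^T) wc mul_mx_scalar -scalemxAl.
rewrite HT /H; move: (w^T *m w) wwE => W WW.
rewrite mulmxBl mul1mx mulmxBr mulmx1 -!scalemxAl -!scalemxAr WW !scalerA.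
rewrite -scalerBl (_ : 2 / c - 2 / c * (2 / c) * c = - (2 / c)); last by field.
by rewrite scaleNr opprK subrK.
Qed.

Lemma deflate_block n (B : 'M[R]_(1 + n)) a : B^T = B ->
  (forall j, B 0 j = a *+ (j == 0)) -> B = block_mx a%:M 0 0 (drsubmx B).
Proof.
move=> symB B0; have l0 : lshift n (0 : 'I_1) = 0 by exact: val_inj.
rewrite -[LHS]submxK; congr block_mx; apply/matrixP => i j.
- by rewrite !ord1 !mxE l0 B0.
- by rewrite !ord1 !mxE l0 B0.
- by rewrite !ord1 -symB !mxE l0 B0.
Qed.

(** Induction by deflation: conjugating by an orthogonal [H] whose first row is a unit eigenvector
    makes the first row, hence by symmetry the first column, vanish off the diagonal. The remaining
    block is symmetric of smaller size. *)
Lemma symmetric_spectral n (A : 'M[R]_n) : A^T = A ->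
  exists (K : 'M[R]_n) d, K *m K^T = 1%:M /\ A = K^T *m diag_mx d *m K.
Proof.
elim: n A => [|n IHn] A symA.
  by exists 1%:M, 0; split; rewrite ?trmx1 ?mulmx1// [LHS]flatmx0 [RHS]flatmx0.
have [a /eigenvalueP[v vA v0]] := symmetric_eigenvalue symA.
pose t := (v *m v^T) 0 0; have t0 : 0 < t by exact: row_normsq_gt0.
pose u := (Num.sqrt t)^-1 *: v.
have u1 : u *m u^T = 1%:M.
  rewrite /u linearZ/= -scalemxAl -scalemxAr scalerA [v *m _]mx11_scalar -/t.
  rewrite scale_scalar_mx -invfM -expr2 sqr_sqrtr ?ltW// mulVf//.
  by rewrite gt_eqF.
have [H HH eH] := unit_row_complete u1.
have eB : delta_mx 0 0 *m (H *m A *m H^T) = a *: delta_mx 0 0 :> 'rV_n.+1.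
  rewrite !mulmxA eH /u -scalemxAl vA scalerA mulrC -scalerA -/u -scalemxAl.
  by rewrite -eH -mulmxA HH mulmx1.
pose B : 'M[R]_(1 + n) := H *m A *m H^T.
have symB : B^T = B by rewrite /B !trmx_mul trmxK symA mulmxA.
have B0 j : B 0 j = a *+ (j == 0).
  by move/rowP/(_ j): eB; rewrite -rowE -/B [LHS]mxE => ->; rewrite !mxE/= mulr_natr.
have BE := deflate_block symB B0.
have [|L [d [LL dE]]] := IHn (drsubmx B); first by rewrite trmx_drsub symB.
pose L' : 'M[R]_(1 + n) := block_mx 1%:M 0 0 L.
have L'E : L' *m L'^T = 1%:M.
  rewrite /L' tr_block_mx mulmx_block !trmx0 !mulmx0 !mul0mx !addr0 !add0r.
  by rewrite trmx1 mulmx1 LL -scalar_mx_block.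
have BL : B = L'^T *m diag_mx (row_mx a%:M d) *m L'.
  rewrite BE dE (diag_mx_row (a%:M : 'rV_1) d) /L' tr_block_mx !mulmx_block.
  rewrite !(mulmx0, mul0mx, addr0, add0r, trmx0, trmx1, mulmx1, mul1mx).
  by congr block_mx; apply/matrixP => i j; rewrite !ord1 !mxE.
exists (L' *m H), (row_mx a%:M d); split.
  by rewrite trmx_mul -mulmxA (mulmxA H) HH mul1mx.
have HtH := mulmx1C HH.
have -> : A = H^T *m B *m H.
  by rewrite /B !mulmxA HtH mul1mx -mulmxA HtH mulmx1.
by rewrite BL trmx_mul !mulmxA.
Qed.

End spectral.

(** * Functional calculus for symmetric matrices *)

Section functional_calculus.
Context {R : realType} {n : nat}.
Implicit Types (K L A B : 'M[R]_n) (d e : 'rV[R]_n).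

(** For orthogonal [K], the rows of [K] are eigenvectors and [d] lists the eigenvalues, so a
    function of the matrix amounts to that function applied to [d]. *)
Definition diagconj K d : 'M[R]_n := K^T *m diag_mx d *m K.

Lemma diagconjE K d i j : diagconj K d i j = \sum_k d 0 k * K k i * K k j.
Proof.
rewrite /diagconj -mulmxA mul_diag_mx !mxE; apply: eq_bigr => k _.
by rewrite !mxE mulrCA mulrA.
Qed.

Lemma tr_diagconj K d : (diagconj K d)^T = diagconj K d.
Proof. by rewrite /diagconj !trmx_mul trmxK tr_diag_mx mulmxA. Qed.

Lemma diagconjD K d e : diagconj K d + diagconj K e = diagconj K (d + e).
Proof. by rewrite /diagconj [in RHS]raddfD/= mulmxDr mulmxDl. Qed.

Lemma diagconjZ K a d : a *: diagconj K d = diagconj K (a *: d).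
Proof. by rewrite /diagconj [in RHS]linearZ/= -scalemxAr -scalemxAl. Qed.

Section orthogonal.
Variable K : 'M[R]_n.
Hypothesis KK : K *m K^T = 1%:M.

Lemma diagconjM d e :
  diagconj K d *m diagconj K e = diagconj K (\row_j (d 0 j * e 0 j)).
Proof.
by rewrite /diagconj !mulmxA -(mulmxA _ K) KK mulmx1 -(mulmxA K^T) mulmx_diag.
Qed.

Lemma diagconj_const a : diagconj K (const_mx a) = a%:M.
Proof.
by rewrite /diagconj diag_const_mx mul_mx_scalar -scalemxAl (mulmx1C KK) scalemx1.
Qed.

Lemma mxtrace_diagconj d : \tr (diagconj K d) = \sum_i d 0 i.
Proof. by rewrite /diagconj mxtrace_mulC mulmxA KK mul1mx mxtrace_diag. Qed.

Lemma char_poly_diagconj d :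
  char_poly (diagconj K d) = \prod_i ('X - (d 0 i)%:P).
Proof.
have -> : char_poly (diagconj K d) = char_poly (diag_mx d).
  rewrite /char_poly /char_poly_mx.
  have KKX : map_mx polyC K *m map_mx polyC K^T = 1%:M :> 'M[{poly R}]_n.
    by rewrite -map_mxM KK map_mx1.
  have -> : 'X%:M - map_mx polyC (diagconj K d) =
      map_mx polyC K^T *m ('X%:M - map_mx polyC (diag_mx d)) *m map_mx polyC K.
    rewrite mulmxBr mulmxBl mul_mx_scalar -scalemxAl (mulmx1C KKX) scalemx1.
    by rewrite -!map_mxM.
  by rewrite !det_mulmx mulrAC -det_mulmx (mulmx1C KKX) det1 mul1r.
rewrite char_poly_trig; last by exact/is_diag_mx_is_trig/diag_mx_is_diag.
by apply: eq_bigr => i _; rewrite mxE eqxx.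
Qed.

(** [eigvals] is an arbitrary choice of a list of roots, but unique factorization into linear
    factors makes it a permutation of [d], and sums ignore the order. *)
Lemma sum_eigvals_diagconj (F : R -> R) d :
  \sum_(x <- eigvals (diagconj K d)) F x = \sum_i F (d 0 i).
Proof.
have dE : char_poly (diagconj K d) =
    \prod_(x <- [seq d 0 i | i <- enum 'I_n]) ('X - x%:P).
  by rewrite char_poly_diagconj big_map enumT.
have /xgetI-/(_ [::]) : [set s | char_poly (diagconj K d) =
  \prod_(x <- s) ('X - x%:P)] [seq d 0 i | i <- enum 'I_n] by [].
rewrite -/(eigvals _)/= {1}dE => /prod_XsubC_eq /(perm_big _)/= <-.
by rewrite big_map enumT.
Qed.

Lemma quadform_diagconj d (v : 'cV[R]_n) :
  (v^T *m diagconj K d *m v) 0 0 = \sum_i d 0 i * (K *m v) i 0 ^+ 2.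
Proof.
rewrite /diagconj !mulmxA -trmx_mul -mulmxA -mulmxA mul_diag_mx mxE.
by apply: eq_bigr => i _; rewrite !mxE mulrCA expr2.
Qed.

Lemma sqnorm_orthogonal (v : 'cV[R]_n) :
  (v^T *m v) 0 0 = \sum_i (K *m v) i 0 ^+ 2.
Proof.
have -> : v^T *m v = (K *m v)^T *m (K *m v).
  by rewrite trmx_mul mulmxA -(mulmxA v^T) (mulmx1C KK) mulmx1.
by rewrite mxE; apply: eq_bigr => i _; rewrite mxE expr2.
Qed.

End orthogonal.

Lemma posdef_diagconj K d : K *m K^T = 1%:M -> (forall i, 0 < d 0 i) ->
  posdefmx (diagconj K d).
Proof.
move=> KK d0; split; first exact/symmetricmxP/tr_diagconj.
move=> v v0; rewrite quadform_diagconj lt_neqAle eq_sym.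
have ge0 i : 0 <= d 0 i * (K *m v) i 0 ^+ 2 by rewrite mulr_ge0 ?sqr_ge0 ?ltW.
rewrite sumr_ge0// andbT; apply: contra_neq v0 => /psumr_eq0P K0.
rewrite -[v]mul1mx -(mulmx1C KK) -mulmxA (_ : K *m v = 0) ?mulmx0//.
apply/colP => i; rewrite [RHS]mxE; have /eqP := K0 (fun i _ => ge0 i) i isT.
by rewrite mulf_eq0 gt_eqF//= sqrf_eq0 => /eqP.
Qed.

Lemma posdef_spectral A : posdefmx A ->
  exists K d, [/\ K *m K^T = 1%:M, forall i, 0 < d 0 i & A = diagconj K d].
Proof.
move=> [/symmetricmxP symA posA]; have [K [d [KK AE]]] := symmetric_spectral symA.
exists K, d; split=> // i; have /posA : K^T *m delta_mx i 0 != 0 :> 'cV_n.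
  apply/eqP => /(congr1 (mulmx K)); rewrite mulmxA KK mul1mx mulmx0.
  by move/colP/(_ i)/eqP; rewrite !mxE !eqxx oner_eq0.
rewrite AE quadform_diagconj mulmxA KK mul1mx (bigD1 i)//= big1 ?addr0.
  by rewrite mxE !eqxx expr1n mulr1.
by move=> j ji; rewrite mxE (negPf ji) expr0n mulr0.
Qed.

(** The functional calculus does not depend on the diagonalization: [W = L *m K^T] intertwines the
    two diagonal matrices, so a nonzero entry [W i j] forces [e 0 i = d 0 j], and [W] intertwines
    their images under [f] as well. *)
Lemma diagconj_map_uniq (f : R -> R) K L d e :
  K *m K^T = 1%:M -> L *m L^T = 1%:M -> diagconj L e = diagconj K d ->
  diagconj L (map_mx f e) = diagconj K (map_mx f d).
Proof.
have comm (W : 'M[R]_n) : diag_mx e *m W = W *m diag_mx d ->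
    diag_mx (map_mx f e) *m W = W *m diag_mx (map_mx f d).
  rewrite !mul_diag_mx !mul_mx_diag => WE; apply/matrixP => i j.
  rewrite !mxE mulrC; have [->|Wij] := eqVneq (W i j) 0; first by rewrite !mul0r.
  by congr (_ * f _); move/matrixP/(_ i j): WE; rewrite !mxE mulrC => /(mulfI Wij).
move=> KK LL /(congr1 (fun M => L *m M *m K^T)).
rewrite /diagconj !mulmxA LL mul1mx -[in RHS]mulmxA KK mulmx1 -[in LHS]mulmxA.
move=> /comm /(congr1 (fun M => L^T *m M *m K)).
by rewrite !mulmxA (mulmx1C LL) mul1mx -!mulmxA (mulmx1C KK) mulmx1.
Qed.

(** Uniqueness of the positive definite root: if [B] has eigenvalues [e], its square has eigenvalues
    [e ^+ 2], and [diagconj_map_uniq] for [Num.sqrt] recovers [B]. Existence excludes the dummy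
    value of [sqrtmx]. *)
Lemma sqrtmx_diagconj K d : K *m K^T = 1%:M -> (forall i, 0 < d 0 i) ->
  sqrtmx (diagconj K d) = diagconj K (map_mx Num.sqrt d).
Proof.
move=> KK d0; rewrite /sqrtmx; case: xgetP => [B _ [/posdef_spectral] | ].
  move=> [L [e [LL e0 ->]]]; rewrite diagconjM// => BB.
  rewrite -(diagconj_map_uniq Num.sqrt KK LL BB); congr diagconj.
  by apply/rowP => i; rewrite !mxE -expr2 sqrtr_sqr gtr0_norm.
move=> /(_ (diagconj K (map_mx Num.sqrt d))) []; split.
  by apply: posdef_diagconj => // i; rewrite mxE sqrtr_gt0.
rewrite diagconjM//; congr diagconj; apply/rowP => i.
by rewrite !mxE -expr2 sqr_sqrtr// ltW.
Qed.

Lemma posdef_sqrtmx A : posdefmx A -> posdefmx (sqrtmx A).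
Proof.
move=> /posdef_spectral[K [d [KK d0 ->]]]; rewrite sqrtmx_diagconj//.
by apply: posdef_diagconj => // i; rewrite mxE sqrtr_gt0.
Qed.

Lemma sqrtmx_sqr A : posdefmx A -> sqrtmx A *m sqrtmx A = A.
Proof.
move=> /posdef_spectral[K [d [KK d0 ->]]]; rewrite sqrtmx_diagconj// diagconjM//.
congr diagconj; apply/rowP => i; by rewrite !mxE -expr2 sqr_sqrtr// ltW.
Qed.

Lemma tr_sqrtmx A : posdefmx A -> (sqrtmx A)^T = sqrtmx A.
Proof. by move=> /posdef_sqrtmx[/symmetricmxP]. Qed.

Lemma sqrtmx1 : sqrtmx (1%:M : 'M[R]_n) = 1%:M.
Proof.
have I1 : 1%:M *m 1%:M^T = 1%:M :> 'M[R]_n by rewrite trmx1 mulmx1.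
rewrite -[in LHS](diagconj_const I1) sqrtmx_diagconj//; last by move=> i; rewrite mxE.
by rewrite map_const_mx sqrtr1 diagconj_const.
Qed.

Lemma posdef_conj A B : posdefmx A -> posdefmx B ->
  posdefmx (sqrtmx A *m B *m sqrtmx A).
Proof.
move=> pA [/symmetricmxP symB posB]; have sA := tr_sqrtmx pA; split.
  by apply/symmetricmxP; rewrite !trmx_mul symB sA mulmxA.
move=> v v0; rewrite !mulmxA -[sqrtmx A in X in X *m B]sA -trmx_mul -mulmxA.
(* If the root of [A] killed [v], then the quadratic form of [A] would vanish at [v]. *)
apply: posB; apply: contra_neq v0 => Av0.
have [_ /(_ v)] := pA; rewrite -(sqrtmx_sqr pA) !mulmxA -mulmxA Av0 mulmx0.
by rewrite mxE ltxx; case: eqVneq => // _ /(_ isT).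
Qed.

Lemma dR1_diagconj K d : K *m K^T = 1%:M -> (forall i, 0 < d 0 i) ->
  dR 1%:M (diagconj K d) = Num.sqrt (\sum_i ln (d 0 i) ^+ 2).
Proof.
move=> KK d0; rewrite /dR sqrtmx1 invmx1 mul1mx mulmx1.
by rewrite (sum_eigvals_diagconj KK (fun x => ln x ^+ 2)).
Qed.

Lemma dR1_ge0 A : 0 <= dR 1%:M A.
Proof. exact: sqrtr_ge0. Qed.

(** Each [|ln (d 0 i)|] is at most the Euclidean norm of the vector of logarithms, which is
    [dR 1%:M A]; this confines all eigenvalues between the two exponentials. *)
Lemma quadform_dR1 A (v : 'cV[R]_n) : posdefmx A ->
  expR (- dR 1%:M A) * (v^T *m v) 0 0 <= (v^T *m A *m v) 0 0 <=
  expR (dR 1%:M A) * (v^T *m v) 0 0.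
Proof.
move=> /posdef_spectral[K [d [KK d0 AE]]]; rewrite (sqnorm_orthogonal KK).
have lnd i : `|ln (d 0 i)| <= dR 1%:M A.
  rewrite AE dR1_diagconj// -sqrtr_sqr ler_sqrt; last first.
    by rewrite sumr_ge0// => j _; rewrite sqr_ge0.
  by rewrite (bigD1 i)//= lerDl sumr_ge0// => j _; rewrite sqr_ge0.
have dbd i : expR (- dR 1%:M A) <= d 0 i <= expR (dR 1%:M A).
  move: (dR _ _) (lnd i) => r; rewrite ler_norml => /andP[l u].
  by rewrite -[d 0 i]lnK ?posrE// !ler_expR l u.
move: (dR _ _) dbd => r dbd; rewrite AE quadform_diagconj.
rewrite !mulr_sumr.
by apply/andP; split; apply: ler_sum => i _; have /andP[l u] := dbd i;
  rewrite ler_wpM2r ?sqr_ge0.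
Qed.

(** A partial converse of [quadform_dR1]: testing on eigenvectors gives [|ln (d 0 i)| <= r]. The sum
    of squares is then at most [n * r ^+ 2], bounded crudely by [(n * r) ^+ 2]. *)
Lemma dR1_le A (r : R) : posdefmx A ->
  (forall v : 'cV[R]_n, expR (- r) * (v^T *m v) 0 0 <= (v^T *m A *m v) 0 0 <=
    expR r * (v^T *m v) 0 0) ->
  dR 1%:M A <= n%:R * r.
Proof.
move=> /posdef_spectral[K [d [KK d0 ->]]] H.
have lnd i : `|ln (d 0 i)| <= r.
  have := H (K^T *m delta_mx i 0); rewrite (sqnorm_orthogonal KK) quadform_diagconj.
  rewrite mulmxA KK mul1mx (bigD1 i)//= [in X in _ <= X <= _](bigD1 i)//=.
  rewrite !big1 ?addr0; try by move=> j /negPf ji; rewrite mxE ji expr0n/= ?mulr0.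
  rewrite mxE !eqxx expr1n !mulr1 ler_norml => /andP[l u].
  by rewrite -[- r]expRK -[r in X in _ && X]expRK !ler_ln ?posrE ?expR_gt0// l u.
rewrite dR1_diagconj//.
(* The sign of [r] is only known once an index exists, so dimension zero is treated apart. *)
have r0 (i : 'I_n) : 0 <= r by exact: le_trans (lnd i).
have [n0|/eqP] := eqVneq n 0%N.
  rewrite big1 ?sqrtr0; first by rewrite n0 mul0r.
  by move=> i; have := ltn_ord i; rewrite {2}n0.
case: (posnP n) => // n0 _; have {}r0 := r0 (Ordinal n0).
rewrite -[leRHS]ger0_norm ?mulr_ge0// -sqrtr_sqr ler_sqrt ?sqr_ge0//.
apply: (@le_trans _ _ (\sum_(i < n) r ^+ 2)).
  apply: ler_sum => i _; rewrite -[leLHS]real_normK ?num_real//.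
  by rewrite lerXn2r ?nnegrE.
rewrite sumr_const card_ord -[leLHS]mulr_natl exprMn ler_wpM2r ?sqr_ge0//.
by rewrite -natrX ler_nat; case: (n) n0 => // k _; rewrite expnS expn1 leq_pmulr.
Qed.

Lemma scaled_bounds_trans (a a' b b' x y z : R) : 0 <= b -> 0 <= b' ->
  a * x <= y <= a' * x -> b * y <= z <= b' * y -> a * b * x <= z <= a' * b' * x.
Proof.
move=> b0 b'0 /andP[ax ya] /andP[bx yb]; apply/andP; split.
  by apply: le_trans bx; rewrite -mulrA mulrCA ler_wpM2l.
by apply: (le_trans yb); rewrite -mulrA [leRHS]mulrCA ler_wpM2l.
Qed.

(** The form of the product at [v] is that of [B] at [sqrtmx A *m v], whose squared norm is the form
    of [A] at [v]. The bounds of [quadform_dR1] for [A] and [B] therefore multiply. *)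
Lemma dR1_conj A B : posdefmx A -> posdefmx B ->
  dR 1%:M (sqrtmx A *m B *m sqrtmx A) <= n%:R * (dR 1%:M A + dR 1%:M B).
Proof.
move=> pA pB; apply: dR1_le; first exact: posdef_conj.
move=> v; have sA := tr_sqrtmx pA.
have -> : v^T *m (sqrtmx A *m B *m sqrtmx A) *m v =
    (sqrtmx A *m v)^T *m B *m (sqrtmx A *m v).
  by rewrite trmx_mul sA !mulmxA.
have AE : (sqrtmx A *m v)^T *m (sqrtmx A *m v) = v^T *m A *m v.
  by rewrite trmx_mul sA !mulmxA -(mulmxA _ _ (sqrtmx A)) sqrtmx_sqr.
have := quadform_dR1 (sqrtmx A *m v) pB; rewrite AE opprD !expRD.
exact: (scaled_bounds_trans (expR_ge0 _) (expR_ge0 _) (quadform_dR1 v pA)).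
Qed.

End functional_calculus.

(** * Measurability of matrix functions *)

Section measurable_matrices.
Context {d : measure_display} {T : measurableType d} {R : realType}.

Lemma measurable_coord m n i j :
  measurable_fun setT (fun A : 'M[R]_(m, n) => A i j).
Proof.
move=> _ B mB; rewrite setTI; apply: sub_sigma_algebra.
by exists (i, j) => //=; exists B => //; rewrite setTI.
Qed.

Lemma measurable_mxP m n (f : T -> 'M[R]_(m, n)) :
  measurable_fun setT f <-> forall i j, measurable_fun setT (fun w => f w i j).
Proof.
split=> [mf i j|mf].
  exact: (measurableT_comp (measurable_coord i j) mf).
apply: (@measurability _ _ _ _ _ _ (\bigcup_(ij in [set: 'I_m * 'I_n])
  preimage_set_system setT (fun A : 'M[R]_(m, n) => A ij.1 ij.2) measurable)) => //.
move=> _ [_ [[i j] _ [B mB <-]] <-]; rewrite !setTI.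
by have := mf i j measurableT _ mB; rewrite setTI.
Qed.

Lemma measurable_mulmx m n p (f : T -> 'M[R]_(m, n)) (g : T -> 'M[R]_(n, p)) :
  measurable_fun setT f -> measurable_fun setT g ->
  measurable_fun setT (fun w => f w *m g w).
Proof.
move=> /measurable_mxP mf /measurable_mxP mg; apply/measurable_mxP => i j.
under eq_fun do rewrite mxE.
by apply: measurable_sum => k; exact: measurable_funM.
Qed.

Lemma measurable_addmx m n (f g : T -> 'M[R]_(m, n)) :
  measurable_fun setT f -> measurable_fun setT g ->
  measurable_fun setT (fun w => f w + g w).
Proof.
move=> /measurable_mxP mf /measurable_mxP mg; apply/measurable_mxP => i j.
under eq_fun do rewrite mxE.
exact: measurable_funD.
Qed.

Lemma measurable_scalemx m n (a : T -> R) (f : T -> 'M[R]_(m, n)) :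
  measurable_fun setT a -> measurable_fun setT f ->
  measurable_fun setT (fun w => a w *: f w).
Proof.
move=> ma /measurable_mxP mf; apply/measurable_mxP => i j.
under eq_fun do rewrite mxE.
exact: measurable_funM.
Qed.

Lemma measurable_mxtrace n (f : T -> 'M[R]_n) :
  measurable_fun setT f -> measurable_fun setT (fun w => \tr (f w)).
Proof. by move=> /measurable_mxP mf; apply: measurable_sum. Qed.

Lemma measurable_sqrtr (f : T -> R) :
  measurable_fun setT f -> measurable_fun setT (fun w => Num.sqrt (f w)).
Proof.
move=> mf; apply: (measurableT_comp _ mf).
by apply: continuous_measurable_fun; exact: sqrt_continuous.
Qed.

(* The superior limit is measurable in x whether or not the sequence converges,
   so no measurability of the cone of positive definite matrices is needed. *)
Definition fun_lim (S : Type) (h : nat -> S -> R) (x : S) : R :=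
  fine (limn_esup (fun k => (h k x)%:E)).

Lemma measurable_fun_lim (h : nat -> T -> R) :
  (forall k, measurable_fun setT (h k)) -> measurable_fun setT (fun_lim h).
Proof.
move=> mh; apply: (measurableT_comp (fine_measurable measurableT)).
by apply: measurable_fun_limn_esup => k; exact/measurable_EFinP.
Qed.

Lemma fun_lim_cvg (S : Type) (h : nat -> S -> R) x (l : R) :
  h k x @[k --> \oo] --> l -> fun_lim h x = l.
Proof.
move=> hl; have hE : (h k x)%:E @[k --> \oo] --> l%:E.
  by apply/fine_cvgP; split; [exact: nearW|exact: hl].
rewrite /fun_lim is_cvg_limn_esupE; last by apply/cvg_ex; exists l%:E.
by rewrite (cvg_lim _ hE).
Qed.

End measurable_matrices.

Lemma cvgr_sum (K : numFieldType) (I : Type) (r : seq I) (u : I -> nat -> K)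
    (l : I -> K) :
  (forall i, u i k @[k --> \oo] --> l i) ->
  \sum_(i <- r) u i k @[k --> \oo] --> \sum_(i <- r) l i.
Proof.
move=> ul; elim: r => [|i r IHr].
  by rewrite big_nil; under eq_fun do rewrite big_nil; exact: cvg_cst.
rewrite big_cons; under eq_fun do rewrite big_cons.
exact: cvgD (ul i) IHr.
Qed.

Lemma cvgr_diagconj (R : realType) n (K : 'M[R]_n) (e : nat -> 'rV[R]_n)
    (l : 'rV[R]_n) i j :
  (forall k, e p 0 k @[p --> \oo] --> l 0 k) ->
  diagconj K (e p) i j @[p --> \oo] --> diagconj K l i j.
Proof.
move=> el; rewrite diagconjE; under eq_fun do rewrite diagconjE.
apply: cvgr_sum => k; apply: cvgM; last exact: cvg_cst.
by apply: cvgM; [exact: el|exact: cvg_cst].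
Qed.

(** * Square roots as limits of a polynomial iteration *)

Section sqrt_iteration.
Context {R : realType}.
Implicit Types a : R.

(** Unlike Newton's iteration, this one never divides by [y], so its matrix analogue needs no
    inverse of the iterate. *)
Definition sqrt_iter a k : R := iter k (fun y => y + (a - y ^+ 2) / 2) 0.

(** With [s] the root of [a], one step multiplies the error [s - y] by [1 - (s + y) / 2], which lies
    between 0 and [1 - s / 2] as long as [0 <= y <= s <= 1]. *)
Lemma sqrt_iter_bounds a k : 0 < a <= 1 ->
  0 <= sqrt_iter a k <= Num.sqrt a /\
  Num.sqrt a - sqrt_iter a k <= (1 - Num.sqrt a / 2) ^+ k.
Proof.
move=> /andP[a0 a1]; set s := Num.sqrt a.
have s0 : 0 < s by rewrite sqrtr_gt0.
have s1 : s <= 1 by rewrite -sqrtr1 ler_sqrt.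
have aE : a = s ^+ 2 by rewrite sqr_sqrtr// ltW.
elim: k => [|k [/andP[y0 ys] IH]]; first by rewrite /= lexx ltW// subr0 expr0.
rewrite /sqrt_iter iterS -/(sqrt_iter a k); move: (sqrt_iter a k) y0 ys IH => y y0 ys IH.
have stepE : s - (y + (a - y ^+ 2) / 2) = (s - y) * (1 - (s + y) / 2).
  by rewrite aE; field.
split.
  rewrite -[_ <= s]subr_ge0 stepE; apply/andP; split.
    by rewrite addr_ge0// divr_ge0// subr_ge0 aE ler_sqr ?nnegrE// ltW.
  by apply: mulr_ge0; lra.
rewrite stepE exprSr; apply: ler_pM => //; lra.
Qed.

Lemma cvg_sqrt_iter a : 0 < a <= 1 -> sqrt_iter a k @[k --> \oo] --> Num.sqrt a.
Proof.
move=> a01; pose q := 1 - Num.sqrt a / 2.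
have q01 : `|q| < 1.
  have /andP[a0 a1] := a01; have s0 : 0 < Num.sqrt a by rewrite sqrtr_gt0.
  have s1 : Num.sqrt a <= 1 by rewrite -sqrtr1 ler_sqrt.
  by rewrite /q ger0_norm; lra.
have lo : Num.sqrt a - q ^+ k @[k --> \oo] --> Num.sqrt a.
  by rewrite -[X in _ --> X]subr0; apply: cvgB; [exact: cvg_cst|exact: cvg_expr].
apply: (squeeze_cvgr _ lo (cvg_cst (Num.sqrt a))).
apply: nearW => k /=; have [/andP[_ ys] h] := sqrt_iter_bounds k a01.
by rewrite ys andbT lerBlDr addrC -lerBlDr.
Qed.

End sqrt_iteration.

Section total_sqrtmx.
Context {R : realType} {n : nat}.
Implicit Types A : 'M[R]_n.

(* The scaling by the trace brings the eigenvalues of a positive definite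
   matrix into the interval (0, 1] on which sqrt_iter converges. *)
Definition sqrtmx_iter k A : 'M[R]_n :=
  iter k (fun Y => Y + 2^-1 *: (\tr A `^ (-1) *: A - Y *m Y)) 0.

(** The factor [Num.sqrt (\tr B)] undoes the scaling by the trace. The function is defined on all
    matrices, which makes it measurable on the whole space. *)
Definition sqrtmx_lim A : 'M[R]_n :=
  \matrix_(i, j) fun_lim (fun k B => Num.sqrt (\tr B) * sqrtmx_iter k B i j) A.

Lemma measurable_sqrtmx_iter k :
  measurable_fun setT (sqrtmx_iter k : 'M[R]_n -> 'M[R]_n).
Proof.
elim: k => [|k IHk]; first exact: measurable_cst.
have idm : measurable_fun setT (@id 'M[R]_n) by exact: measurable_id.
rewrite [X in measurable_fun _ X](_ : _ = fun A => sqrtmx_iter k A +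
  2^-1 *: (\tr A `^ (-1) *: A + (-1) *: (sqrtmx_iter k A *m sqrtmx_iter k A))).
  apply: measurable_addmx => //; apply: measurable_scalemx.
    exact: measurable_cst.
  apply: measurable_addmx.
    apply: measurable_scalemx => //.
    apply: (measurableT_comp (measurable_powR (-1))).
    exact: measurable_mxtrace.
  apply: measurable_scalemx; first exact: measurable_cst.
  exact: measurable_mulmx.
by apply/funext => A; rewrite scaleN1r.
Qed.

Lemma measurable_sqrtmx_lim : measurable_fun setT sqrtmx_lim.
Proof.
apply/measurable_mxP => i j; under eq_fun do rewrite mxE.
apply: measurable_fun_lim => k; apply: measurable_funM.
  by apply: measurable_sqrtr; apply: measurable_mxtrace; exact: measurable_id.
by have /measurable_mxP := measurable_sqrtmx_iter k; exact.
Qed.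

(** In an eigenbasis the matrix iteration is [sqrt_iter] run separately on each [d 0 i / t], with
    [t] the trace. *)
Lemma sqrtmx_limE A : posdefmx A -> sqrtmx_lim A = sqrtmx A.
Proof.
move=> /posdef_spectral[K [d [KK d0 ->]]]; rewrite sqrtmx_diagconj//.
pose t := \sum_i d 0 i.
have iterE k : sqrtmx_iter k (diagconj K d) =
    diagconj K (\row_i sqrt_iter (d 0 i / t) k).
  elim: k => [|k IHk].
    apply/matrixP => i j; rewrite diagconjE mxE big1// => l _.
    by rewrite mxE/= !mul0r.
  rewrite /sqrtmx_iter iterS -/(sqrtmx_iter _ _) IHk mxtrace_diagconj//.
  rewrite powR_inv1 ?sumr_ge0// => [|i _]; last exact: ltW.
  rewrite diagconjM// -scaleN1r !diagconjZ diagconjD diagconjZ diagconjD.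
  by congr diagconj; apply/rowP => i; rewrite !mxE/= -/t; ring.
apply/matrixP => i j; rewrite mxE; apply: fun_lim_cvg.
under eq_fun => k do rewrite iterE mxtrace_diagconj// -/t.
have dt k : d 0 k <= t.
  by rewrite /t (bigD1 k)//= lerDl sumr_ge0// => l _; exact: ltW.
have t0 (k : 'I_n) : 0 < t by exact: lt_le_trans (dt k).
have -> : diagconj K (map_mx Num.sqrt d) i j =
    Num.sqrt t * diagconj K (\row_k Num.sqrt (d 0 k / t)) i j.
  rewrite !diagconjE mulr_sumr; apply: eq_bigr => k _; rewrite !mxE !mulrA.
  by rewrite -sqrtrM ?ltW ?(t0 k)// [t * _]mulrC divfK ?gt_eqF ?(t0 k).
apply: cvgM; first exact: cvg_cst.
apply: cvgr_diagconj => k; rewrite mxE; under eq_fun do rewrite mxE.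
by apply: cvg_sqrt_iter; rewrite divr_gt0 ?(t0 k)//= ler_pdivrMr ?(t0 k)// mul1r.
Qed.

End total_sqrtmx.

(** * The logarithm as a limit of iterated square roots *)

Section log_limit.
Context {R : realType}.

Lemma iter_sqrtr_expR k (x : R) : iter k Num.sqrt (expR x) = expR (x / 2 ^+ k).
Proof.
elim: k => [|k IHk]; first by rewrite expr0 divr1.
rewrite iterS IHk -[RHS]ger0_norm ?expR_ge0// -sqrtr_sqr -expRM_natl.
by congr (Num.sqrt (expR _)); rewrite exprS; field.
Qed.

(** With [x = ln a] and [h = x / 2 ^+ k], the [k]-th term is [2 ^+ k * (expR h - 1)]. The
    inequalities [1 + h <= expR h <= (1 - h)^-1], the second for [h < 1], squeeze it between [x] and
    [x / (1 - h)]. *)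
Lemma cvg_ln_iter_sqrt (a : R) : 0 < a ->
  2 ^+ k * (iter k Num.sqrt a - 1) @[k --> \oo] --> ln a.
Proof.
move=> a0; have : expR (ln a) = a by rewrite lnK ?posrE.
move: (ln a) => x <-.
under eq_fun do rewrite iter_sqrtr_expR.
have h0 : x / 2 ^+ k @[k --> \oo] --> (0 : R).
  rewrite -[X in _ --> X](mulr0 x); under eq_fun do rewrite -exprVn.
  apply: cvgM; first exact: cvg_cst.
  by apply: cvg_expr; rewrite ger0_norm; lra.
have up : x / (1 - x / 2 ^+ k) @[k --> \oo] --> x.
  rewrite -[X in _ --> X]divr1; apply: cvgM; first exact: cvg_cst.
  apply: cvgV; first by rewrite oner_eq0.
  rewrite -[X in _ --> X]subr0; apply: cvgB => //; exact: cvg_cst.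
apply: (squeeze_cvgr _ (cvg_cst x) up).
have : \forall k \near \oo, x / 2 ^+ k < 1 by exact: (cvgr_lt 0 h0).
apply: filterS => k hk /=.
have p0 : 0 < 2 ^+ k :> R by rewrite exprn_gt0.
have xE : x = 2 ^+ k * (x / 2 ^+ k) by field; rewrite gt_eqF.
move: (x / 2 ^+ k) hk xE => h h1 ->; rewrite -mulrA !ler_pM2l//.
apply/andP; split; first by rewrite lerBrDl expR_ge1Dx.
rewrite lerBlDr -[X in _ + X](@divff _ (1 - h)); last by lra.
rewrite -mulrDl addrC subrK mul1r -[h in expR h]opprK expRN lef_pV2 ?posrE ?expR_gt0//.
  exact: expR_ge1Dx.
lra.
Qed.

End log_limit.

Section total_dR.
Context {R : realType} {n : nat}.
Implicit Types A : 'M[R]_n.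

(** For positive definite [B], [2 ^+ k] times [C] tends to the logarithm of [B], and the trace of
    its square is the sum of the squared logarithms of the eigenvalues; hence the factor
    [4 ^+ k]. *)
Definition dR1_lim A : R := Num.sqrt (fun_lim (fun k B =>
  let C := iter k sqrtmx_lim B + (-1) *: 1%:M in 4 ^+ k * \tr (C *m C)) A).

Lemma measurable_dR1_lim : measurable_fun setT dR1_lim.
Proof.
apply: measurable_sqrtr; apply: measurable_fun_lim => k.
apply: measurable_funM; first exact: measurable_cst.
have mC : measurable_fun setT
    (fun A => iter k sqrtmx_lim A + (-1) *: (1%:M : 'M[R]_n)).
  apply: measurable_addmx; last exact: measurable_cst.
  elim: k => [|k IHk]; first exact: measurable_id.
  exact: measurableT_comp measurable_sqrtmx_lim IHk.
by apply: measurable_mxtrace; exact: measurable_mulmx.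
Qed.

Lemma dR1_limE A : posdefmx A -> dR1_lim A = dR 1%:M A.
Proof.
move=> /posdef_spectral[K [d [KK d0 ->]]]; rewrite dR1_diagconj//.
have iterE k : iter k sqrtmx_lim (diagconj K d) =
    diagconj K (map_mx (iter k Num.sqrt) d).
  elim: k => [|k IHk]; first by rewrite map_mx_id.
  have pos i : 0 < map_mx (iter k Num.sqrt) d 0 i.
    by rewrite mxE; elim: k {IHk} => //= k IHk; rewrite sqrtr_gt0.
  rewrite iterS IHk sqrtmx_limE ?sqrtmx_diagconj//; last exact: posdef_diagconj.
  by congr diagconj; apply/rowP => i; rewrite !mxE.
congr Num.sqrt; apply: fun_lim_cvg => /=.
have E k : 4 ^+ k * \tr ((iter k sqrtmx_lim (diagconj K d) + (-1) *: 1%:M) *m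
      (iter k sqrtmx_lim (diagconj K d) + (-1) *: 1%:M)) =
    \sum_i (2 ^+ k * (iter k Num.sqrt (d 0 i) - 1)) ^+ 2.
  rewrite iterE -(diagconj_const KK 1) diagconjZ diagconjD diagconjM//.
  rewrite mxtrace_diagconj// mulr_sumr; apply: eq_bigr => i _.
  rewrite !mxE exprMn -exprM mulnC exprM (_ : 2 ^+ 2 = 4 :> R); last by ring.
  by ring.
under eq_fun do rewrite E.
apply: cvgr_sum => i; under eq_fun do rewrite expr2.
by rewrite expr2; apply: cvgM; exact: cvg_ln_iter_sqrt.
Qed.

End total_dR.

(** * Spectral norm: entrywise bound and measurability *)

Section specnorm.
Context {R : realType}.

Lemma enorm_ge0 n (v : 'cV[R]_n) : 0 <= enorm v.
Proof. exact: sqrtr_ge0. Qed.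

Lemma normr_le_enorm n (v : 'cV[R]_n) i : `|v i 0| <= enorm v.
Proof.
rewrite -sqrtr_sqr ler_sqrt ?sumr_ge0// => [|j _]; last exact: sqr_ge0.
by rewrite (bigD1 i)//= lerDl sumr_ge0// => j _; exact: sqr_ge0.
Qed.

Lemma enorm_le_sum n (v : 'cV[R]_n) : enorm v <= \sum_i `|v i 0|.
Proof.
have s0 (r : seq 'I_n) : 0 <= \sum_(i <- r) `|v i 0| by rewrite sumr_ge0.
rewrite -[leRHS]ger0_norm// -sqrtr_sqr ler_sqrt ?sqr_ge0//.
elim: (index_enum _) => [|i r IHr]; first by rewrite !big_nil expr0n.
rewrite !big_cons sqrrD real_normK ?num_real// -addrA lerD2l.
by apply: (le_trans IHr); rewrite lerDr mulrn_wge0// mulr_ge0.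
Qed.

Lemma enorm_mulmx_le n (A : 'M[R]_n) (v : 'cV[R]_n) : enorm v <= 1 ->
  enorm (A *m v) <= \sum_i \sum_j `|A i j|.
Proof.
move=> v1; apply: (le_trans (enorm_le_sum _)); apply: ler_sum => i _.
rewrite mxE; apply: (le_trans (ler_norm_sum _ _ _)); apply: ler_sum => j _.
rewrite normrM ler_piMr//; apply: le_trans v1; exact: normr_le_enorm.
Qed.

Let specset n (A : 'M[R]_n) := [set enorm (A *m v) | v in [set v | enorm v <= 1]].

Lemma enorm0 n : enorm (0 : 'cV[R]_n) = 0.
Proof.
by rewrite /enorm big1 ?sqrtr0// => i _; rewrite mxE expr0n.
Qed.

Lemma specset_has_sup n (A : 'M[R]_n) : has_sup (specset A).
Proof.
split; first by exists (enorm (A *m 0)), 0 => //=; rewrite enorm0 ler01.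
by exists (\sum_i \sum_j `|A i j|) => _ [v v1 <-]; exact: enorm_mulmx_le.
Qed.

Lemma specnorm_ge0 n (A : 'M[R]_n) : 0 <= specnorm A.
Proof.
apply: le_trans (enorm_ge0 (A *m 0)) _; apply: sup_upper_bound.
  exact: specset_has_sup.
by exists 0 => //=; rewrite enorm0 ler01.
Qed.

Lemma specnorm_le n (A : 'M[R]_n) : specnorm A <= \sum_i \sum_j `|A i j|.
Proof.
apply: ge_sup; first by have [] := specset_has_sup A.
by move=> _ [v v1 <-]; exact: enorm_mulmx_le.
Qed.

(** The rational is taken on the side of 0, so that approximating the coordinates of a vector never
    leaves the unit ball. *)
Lemma rat_approx_shrink (x e : R) : 0 < e ->
  exists q : rat, `|ratr q| <= `|x| /\ `|ratr q - x| < e.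
Proof.
move=> e0; have pos y : 0 < y -> exists q : rat, `|ratr q| <= y /\ `|ratr q - y| < e.
  move=> y0; have [|q] := @rat_in_itvoo R (Num.max 0 (y - e)) y.
    by rewrite gt_max y0/= ltrBlDr ltrDl.
  rewrite in_itv/= gt_max -andbA => /and3P[q0 qe qy]; exists q.
  by rewrite ger0_norm ?ltW// ltr0_norm ?subr_lt0//; split; lra.
have [x0|x0|->] := ltgtP x 0; last by exists 0; rewrite raddf0 subr0 !normr0.
- have [|q [q1 q2]] := pos (- x); first by rewrite oppr_gt0.
  exists (- q); rewrite raddfN/= normrN (ltr0_norm x0); split=> //.
  by rewrite (_ : - ratr q - x = - (ratr q - - x)) ?normrN//; ring.
- by rewrite gtr0_norm//; have [q q12] := pos _ x0; exists q.
Qed.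

Lemma enorm_rat_approx n (A : 'M[R]_n) (v : 'cV[R]_n) c :
  enorm v <= 1 -> c < enorm (A *m v) ->
  exists q : 'cV[rat]_n, let u := map_mx ratr q : 'cV[R]_n in
    enorm u <= 1 /\ c < enorm (A *m u).
Proof.
move=> v1 cv.
have /choice[q qP] : forall k : nat, exists q : 'cV[rat]_n, forall i,
    `|ratr (q i 0) : R| <= `|v i 0| /\ `|ratr (q i 0) - v i 0| < k.+1%:R^-1.
  move=> k; have /choice[q qP] := fun i =>
    @rat_approx_shrink (v i 0) k.+1%:R^-1 ltac:(by rewrite invr_gt0).
  by exists (\col_i q i) => i; rewrite mxE.
have qv i : ratr (q k i 0) @[k --> \oo] --> v i 0.
  apply/cvgrPdist_lt => e e0; near=> k; rewrite distrC.
  apply: (lt_trans (qP k i).2).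
  by near: k; exact: near_infty_natSinv_lt (PosNum e0).
have : enorm (A *m map_mx ratr (q k)) @[k --> \oo] --> enorm (A *m v).
  apply: (continuous_cvg _ (@sqrt_continuous R _)).
  apply: cvgr_sum => i; rewrite expr2; under eq_fun do rewrite expr2.
  have Ac : (A *m map_mx ratr (q k)) i 0 @[k --> \oo] --> (A *m v) i 0.
    rewrite mxE; under eq_fun do rewrite mxE.
    apply: cvgr_sum => j; apply: cvgM; first exact: cvg_cst.
    by under eq_fun do rewrite mxE; exact: qv.
  exact: cvgM.
move=> /(cvgr_gt _)/(_ _ cv)[N _ /(_ N (leqnn N)) /= hN].
exists (q N); split=> //; apply: le_trans v1.
rewrite ler_sqrt ?sumr_ge0// => [|i _]; last exact: sqr_ge0.
apply: ler_sum => i _; rewrite mxE -[leLHS]real_normK ?num_real//.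
rewrite -[leRHS]real_normK ?num_real// lerXn2r ?nnegrE//.
exact: (qP N i).1.
Unshelve. all: by end_near. Qed.

(** By [enorm_rat_approx] the supremum may be tested on rational vectors of the unit ball, so each
    set of matrices with [c < specnorm A] is a countable union of measurable sets. *)
Lemma measurable_specnorm n : measurable_fun setT (@specnorm R n).
Proof.
move=> _; apply: (measurability _ (RGenOInfty.measurableE R)) => //.
move=> /= _ [_ [c ->] <-]; rewrite preimage_itvoy setTI.
rewrite [X in measurable X](_ : _ = \bigcup_(q : 'cV[rat]_n)
    [set A | (enorm (map_mx ratr q : 'cV[R]_n) <= 1) &&
             (c < enorm (A *m map_mx ratr q))]).
  apply: countable_bigcupT_measurable => [|q]; first exact: countableP.
  have [_|_] := boolP (enorm _ <= 1); last first.
    by rewrite [X in measurable X](_ : _ = set0)//; apply/seteqP; split.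
  have m1 : measurable_fun setT
      (fun A : 'M[R]_n => enorm (A *m map_mx ratr q)).
    apply: measurable_sqrtr; apply: measurable_sum => i.
    apply: measurable_funX.
    have : measurable_fun setT (fun A : 'M[R]_n => A *m map_mx ratr q).
      by apply: measurable_mulmx; [exact: measurable_id|exact: measurable_cst].
    by move=> /measurable_mxP; exact.
  rewrite -[X in measurable X]setTI -preimage_itvoy.
  by apply: m1 => //; exact: measurable_itv.
apply/seteqP; split=> [A /= cA|A [q _ /= /andP[q1 cq]]].
  have [] := @sup_gt R (specset A) c _ cA.
    by have [] := specset_has_sup A.
  move=> _ [v /= v1 <-] cv; have [q [q1 cq]] := enorm_rat_approx v1 cv.
  by exists q => //=; rewrite q1.
apply: (lt_le_trans cq); apply: sup_upper_bound; first exact: specset_has_sup.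
by exists (map_mx ratr q).
Qed.

End specnorm.

(** * Conditional means and independence *)

Section sub_sigma_algebra.
Context {d : measure_display} {T : measurableType d} {R : realType}.
Variables (P : probability T R) (G : set (set T)).
Hypothesis Gm : G `<=` measurable.
Local Notation GT := (g_sigma_algebraType G).
Local Open Scope ereal_scope.

Lemma g_sigma_measurable A : <<s G >> A -> measurable A.
Proof. exact: (smallest_sub (@sigma_algebra_measurable _ T) Gm). Qed.

Lemma measurable_fun_g_sigma d' (E : measurableType d') (f : GT -> E) :
  measurable_fun [set: GT] f -> measurable_fun [set: T] (f : T -> E).
Proof.
by move=> mf _ B mB; apply: g_sigma_measurable; exact: mf.
Qed.

(** The law of this identity map is the restriction of [P] to the sigma-algebra generated by [G]. *)
Definition to_sub : T -> GT := id.

Let measurable_to_sub : measurable_fun setT to_sub.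
Proof. by move=> _ A mA; rewrite setTI; exact: g_sigma_measurable. Qed.

HB.instance Definition _ := isMeasurableFun.Build _ _ T GT to_sub measurable_to_sub.

Definition sub_probability : probability GT R := distribution P to_sub.

Lemma ge0_integral_sub (f : GT -> \bar R) (A : set T) : <<s G >> A ->
  measurable_fun [set: GT] f -> (forall x, 0 <= f x) ->
  \int[sub_probability]_(x in A) f x = \int[P]_(x in A) f x.
Proof.
move=> GA mf f0; rewrite /sub_probability /distribution ge0_integral_pushforward//.
exact: measurable_funTS.
Qed.

Section density.
Variable f : T -> \bar R.
Hypotheses (intf : P.-integrable setT f) (f0 : forall x, 0 <= f x).

Let nu (A : set GT) := \int[P]_(x in A) f x.

Let nu0 : nu set0 = 0. Proof. exact: integral_set0. Qed.

Let nu_ge0 A : 0 <= nu A. Proof. exact: integral_ge0. Qed.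

Let nu_sigma_additive : semi_sigma_additive nu.
Proof.
move=> F mF tF mUF.
apply: (semi_sigma_additive_nng_induced (measurable_int _ intf) f0) => // [i|].
  exact: g_sigma_measurable (mF i).
exact: g_sigma_measurable mUF.
Qed.

HB.instance Definition _ := isMeasure.Build _ _ _ nu nu0 nu_ge0 nu_sigma_additive.

Let nu_fin : fin_num_fun nu.
Proof.
move=> A /g_sigma_measurable mA; apply: integrable_fin_num => //.
exact: integrableS intf.
Qed.

HB.instance Definition _ := @Measure_isFinite.Build _ _ _ nu nu_fin.

(** [Z] is the Radon-Nikodym density of [nu] with respect to the restriction of [P]. Taking it on
    [GT] is what makes it measurable for the coarser sigma-algebra. *)
Lemma integrable_cond_mean_exists : exists Z : GT -> \bar R,
  [/\ forall x, 0 <= Z x, measurable_fun [set: GT] Z &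
      forall A, <<s G >> A -> \int[P]_(x in A) Z x = \int[P]_(x in A) f x].
Proof.
have [|Z [Z0 iZ ZE]] := @radon_nikodym_finite _ GT R sub_probability nu.
  apply/null_content_dominatesP => A mA PA.
  apply: null_set_integral => //; first exact: g_sigma_measurable.
  exact/measurable_funTS/(measurable_int _ intf).
have mZ := measurable_int _ iZ.
by exists Z; split=> // A GA; rewrite -ge0_integral_sub// -ZE.
Qed.

End density.

(** [Y] may have an infinite mean, but its restriction to [B k] is bounded by [k + 1]. The
    conditional means of these pieces are summed, and nonnegativity allows the exchange of sum and
    integral. *)
Lemma ge0_cond_mean_exists (Y : T -> R) : measurable_fun setT Y ->
  (forall x, (0 <= Y x)%R) -> exists Z : GT -> \bar R,
  [/\ forall x, 0 <= Z x, measurable_fun [set: GT] Z &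
      forall A, <<s G >> A -> \int[P]_(x in A) Z x = \int[P]_(x in A) (Y x)%:E].
Proof.
move=> mY Y0; pose B (k : nat) := Y @^-1` `[k%:R, k.+1%:R[%classic.
have mB k : measurable (B k).
  by rewrite -[B k]setTI; apply: mY => //; exact: measurable_itv.
have mYE : measurable_fun setT (EFin \o Y) by exact/measurable_EFinP.
have intYB k : P.-integrable setT ((EFin \o Y) \_ (B k)).
  apply: (@le_integrable _ _ _ P _ measurableT _ (cst k.+1%:R%:E)) => //.
  - by apply/(measurable_restrictT _ (mB k)); exact: measurable_funTS.
  - move=> x _; rewrite patchE; case: ifPn => [|_]; last by rewrite abse0.
    rewrite inE /B/= in_itv/= => /andP[_ Yk].
    by rewrite lee_fin ger0_norm// ger0_norm// ltW.
  - exact: finite_measure_integrable_cst.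
have YB0 k x : 0 <= ((EFin \o Y) \_ (B k)) x.
  by rewrite patchE; case: ifPn => // _; rewrite lee_fin.
have /choice[Z ZP] := fun k => integrable_cond_mean_exists (intYB k) (YB0 k).
exists (fun x => \sum_(0 <= k <oo) Z k x); split=> [x||A GA].
- by apply: nneseries_ge0 => k _ _; have [] := ZP k.
- by apply: ge0_emeasurable_sum => k *; have [] := ZP k.
have mA := g_sigma_measurable GA.
rewrite integral_nneseries//; last by move=> k x _; have [] := ZP k.
  rewrite (eq_eseriesr (g := fun k => \int[P]_(x in A `&` B k) (Y x)%:E)); last first.
    by move=> k _; have [_ _ ->//] := ZP k; rewrite integral_mkcondr.
  (* The integer part of [Y x] is the only [k] with [x] in [B k], which gives both the covering and
     the disjointness. *)
  have AE : A = \bigcup_k (A `&` B k).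
    rewrite -setI_bigcupr; apply/seteqP; split=> [x Ax|x []//]; split=> //.
    exists (Num.truncn (Y x)) => //.
    by rewrite /B/= in_itv/=; exact: truncn_itv.
  rewrite [in RHS]AE ge0_integral_bigcup//.
  - by move=> k; exact: measurableI.
  - exact: measurable_funTS.
  - by move=> x _; rewrite lee_fin.
  apply/trivIsetP => i j _ _; apply: contra_neqP => /eqP/set0P[x [[_ Bi] [_ Bj]]].
  move: Bi Bj; rewrite /B/= !in_itv/= => Bi Bj.
  by rewrite -(truncn_def Bi) (truncn_def Bj).
by move=> k; apply: measurable_funTS; apply: measurable_fun_g_sigma; have [] := ZP k.
Qed.

End sub_sigma_algebra.

(** * Nondecreasing sequences as submartingales *)

Section monotone_submartingale.
Context {d : measure_display} {T : measurableType d} {R : realType}.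
Variable P : probability T R.
Local Open Scope ereal_scope.

Lemma history_gen_measurable d' (E : measurableType d') (Y : nat -> T -> E) n :
  (forall k, measurable_fun setT (Y k)) ->
  \big[setU/set0]_(i < n.+1) preimage_set_system setT (Y i) measurable `<=` measurable.
Proof.
move=> mY A; rewrite -bigcup_mkord_ord => -[i _ [B mB <-]]; exact: mY.
Qed.

Lemma measurable_history d' (E : measurableType d') (Y : nat -> T -> E) n k :
  (k <= n)%N -> measurable_fun [set: g_sigma_algebraType
   (\big[setU/set0]_(i < n.+1) preimage_set_system setT (Y i) measurable)] (Y k).
Proof.
move=> kn _ B mB; apply: sub_sigma_algebra; rewrite -bigcup_mkord_ord.
by exists k => //; exists B => //; rewrite inordK.
Qed.

(** Only the increment is conditioned: [Y n] plus a nonnegative conditional mean of [Y n.+1 - Y n]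
    is a version for [Y n.+1] that dominates [Y n] at every point. *)
Lemma nondecreasing_submartingale_ineq (Y : nat -> T -> R) :
  (forall n, measurable_fun setT (Y n)) -> (forall n x, (0 <= Y n x)%R) ->
  (forall n x, (Y n x <= Y n.+1 x)%R) -> submartingale_ineq P Y.
Proof.
move=> mY Y0 Yle n; have Gm := history_gen_measurable (n := n) mY.
have [||Z [Z0 mZ ZE]] := @ge0_cond_mean_exists _ _ _ P _ Gm (Y n.+1 \- Y n)%R.
- exact: measurable_funB.
- by move=> x; rewrite subr_ge0.
have mYn := measurable_history (Y := Y) (leqnn n).
exists (fun x => (Y n x)%:E + Z x); last by apply: aeW => x; exact: leeDl.
split.
  move=> _ [B mB <-]; rewrite /history /g_sigma_preimage.
  have : measurable_fun [set: g_sigma_algebraType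
   (\big[setU/set0]_(i < n.+1) preimage_set_system setT (Y i) measurable)]
     (fun x => (Y n x)%:E + Z x).
    by apply: emeasurable_funD => //; exact/measurable_EFinP.
  by move=> /(_ measurableT _ mB).
move=> A GA; have mA := g_sigma_measurable Gm GA.
have mYnT k : measurable_fun A (EFin \o Y k).
  by apply: measurable_funTS; exact/measurable_EFinP.
rewrite ge0_integralD//; first last.
- by apply: measurable_funTS; exact: (measurable_fun_g_sigma Gm mZ).
- exact: mYnT.
- by move=> x _; rewrite lee_fin.
rewrite ZE// -ge0_integralD//.
- by apply: eq_integral => x _; rewrite -EFinD addrC subrK.
- by move=> x _; rewrite lee_fin.
- exact: mYnT.
- by move=> x _; rewrite lee_fin subr_ge0.
- by apply/measurable_EFinP; apply: measurable_funB; exact: measurable_funTS.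
Qed.

End monotone_submartingale.

(** * Independence and products of expectations *)

Section independence.
Context {d : measure_display} {T : measurableType d} {R : realType}.
Variable P : probability T R.
Local Open Scope ereal_scope.

(** Independence says that the joint law of the point, seen in the coarser space, and of [Y] agrees
    on rectangles with a product measure. The two are then equal, and Fubini's theorem separates the
    factors. *)
Lemma independent_integralM (G : set (set T)) (f Y : T -> R) :
  G `<=` measurable ->
  measurable_fun [set: g_sigma_algebraType G] f -> measurable_fun setT Y ->
  P.-integrable setT (EFin \o f) -> P.-integrable setT (EFin \o Y) ->
  (forall A B, <<s G >> A -> measurable B ->
    P (A `&` Y @^-1` B) = P A * P (Y @^-1` B)) ->
  P.-integrable setT (fun x => (f x * Y x)%:E) /\
  \int[P]_x (f x * Y x)%:E = \int[P]_x (f x)%:E * \int[P]_x (Y x)%:E.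
Proof.
move=> Gm mf mY intf intY indep.
pose GT := g_sigma_algebraType G.
pose Ym : {mfun T >-> R} := mfun_Sub (mem_set mY).
pose m1 : probability GT R := sub_probability P Gm.
pose m2 : probability (R) R := distribution P Ym.
(* Keeping the point itself as first coordinate leaves [f] a measurable function of the pair. *)
pose phi (x : T) : GT * R := (x, Y x).
have mphi : measurable_fun setT phi.
  apply/measurable_fun_pairP; split; last exact: mY.
  by move=> _ A mA; rewrite setTI; exact: (g_sigma_measurable Gm mA).
pose phim : {mfun T >-> (GT * R)%type} := mfun_Sub (mem_set mphi).
pose joint : probability (GT * R)%type R := distribution P phim.
have jointE X : measurable X -> (m1 \x m2) X = joint X.
  apply: product_measure_unique => A B mA mB.
  exact: indep.
pose F (z : GT * R) := (f z.1 * z.2)%:E.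
have mF : measurable_fun setT F.
  apply/measurable_EFinP; apply: measurable_funM.
    exact: (measurableT_comp mf measurable_fst).
  exact: measurable_snd.
have eq_int (D : set (GT * R)) h : measurable D ->
    \int[joint]_(z in D) h z = \int[m1 \x m2]_(z in D) h z.
  move=> mD; apply: eq_measure_integral => A mA _; exact/esym/jointE.
have m2Y : \int[m2]_y `|y%:E| = \int[P]_x `|(Y x)%:E|.
  rewrite /m2 /distribution ge0_integral_pushforward//.
  exact/measurableT_comp.
have intid : m2.-integrable setT (fun y : R => y%:E).
  apply/integrableP; split; first by apply/measurable_EFinP; exact: measurable_id.
  by rewrite m2Y; have /integrableP[] := intY.
have m2E : \int[m2]_y y%:E = \int[P]_x (Y x)%:E.
  by rewrite /m2 /distribution integral_pushforward.
have Yfin : \int[P]_x (Y x)%:E \is a fin_num by exact: integrable_fin_num intY.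
have m1E : \int[m1]_x (f x)%:E = \int[P]_x (f x)%:E.
  by rewrite /m1 /sub_probability /distribution integral_pushforward//; exact/measurable_EFinP.
have intfm1 : m1.-integrable setT (EFin \o f).
  apply/integrableP; split; first exact/measurable_EFinP.
  rewrite ge0_integral_sub//.
    by have /integrableP[] := intf.
    exact: (@measurableT _ GT).
  by apply: measurableT_comp => //; exact/measurable_EFinP.
have intF : (m1 \x m2).-integrable setT F.
  apply/integrable12ltyP => //.
  have absE x : \int[m2]_y `|F (x, y)| = `|(f x)%:E| * \int[P]_x `|(Y x)%:E|.
    rewrite -m2Y -ge0_integralZl//; last exact/measurableT_comp.
    by apply: eq_integral => y _; rewrite /F/= normrM EFinM.
  under eq_integral do rewrite absE.
  have /integrableP[_ Yoo] := intY.
  have Yf : \int[P]_x `|(Y x)%:E| \is a fin_num.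
    by rewrite ge0_fin_numE// integral_ge0.
  rewrite -(fineK Yf) ge0_integralZr//.
  - apply: lte_mul_pinfty; rewrite ?integral_ge0//.
    + by rewrite ge0_fin_numE ?integral_ge0//; have /integrableP[] := intfm1.
    + by rewrite ltry.
  - by apply: measurableT_comp => //; exact/measurable_EFinP.
  - by rewrite lee_fin fine_ge0// integral_ge0.
have intFphi : P.-integrable setT (F \o phi).
  apply/integrableP; split; first exact: (measurableT_comp mF mphi).
  have -> : \int[P]_x `|(F \o phi) x| = \int[joint]_z `|F z|.
    rewrite /joint /distribution ge0_integral_pushforward//.
    exact: measurableT_comp.
  by rewrite eq_int//; have /integrableP[] := intF.
split; first exact: intFphi.
transitivity (\int[joint]_z F z).
  by rewrite /joint /distribution integral_pushforward.
rewrite eq_int// -integral12_prod_meas1// /fubini_F -m1E.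
under eq_integral do rewrite /F/=.
transitivity (\int[m1]_x ((f x)%:E * \int[P]_x (Y x)%:E)).
  by apply: eq_integral => x _; rewrite -m2E -integralZl.
by rewrite -(fineK Yfin) integralZr.
Qed.

(** Uniqueness of finite measures on a generating pi-system: both sides are measures in [A], and
    they agree on the cylinders [H], where the claim is mutual independence. *)
Lemma history_independent d' (E : measurableType d') (X : nat -> T -> E) n A B :
  (forall k, measurable_fun setT (X k)) -> mutually_independent P X ->
  history X n A -> measurable B ->
  P (A `&` X n.+1 @^-1` B) = P A * P (X n.+1 @^-1` B).
Proof.
move=> mX indX hA mB.
pose H : set (set T) := [set C | exists2 D : nat -> set E,
  forall j, measurable (D j) & C = \bigcap_(j in `I_n.+1) X j @^-1` D j].
have mXB j D : measurable D -> measurable (X j @^-1` D).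
  by move=> mD; rewrite -[_ @^-1` _]setTI; exact: mX.
have Hm : H `<=` measurable.
  move=> _ [D mD ->]; apply: bigcap_measurable => [|j _]; first by exists 0%N.
  exact: mXB.
have HT : H setT.
  exists (fun=> setT) => //; apply/seteqP; split=> // x _ j _ //.
have HI : setI_closed H.
  move=> _ _ [D mD ->] [D' mD' ->]; exists (fun j => D j `&` D' j).
    by move=> j; exact: measurableI.
  apply/seteqP; split=> [x [xD xD'] j jn|x xDD'].
    by split; [exact: xD|exact: xD'].
  by split=> j jn; have [] := xDD' j jn.
have prodE D j0 : (forall j, measurable (D j)) ->
    P (\bigcap_(j in `I_j0) X j @^-1` D j) =
    \prod_(0 <= j < j0) P (X j @^-1` D j).
  move=> mD; have := indX [fset j | j in iota 0 j0]%fset D mD.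
  rewrite (_ : [set` _] = `I_j0); last first.
    by apply/seteqP; split=> j /=; rewrite inE/= mem_iota add0n.
  move=> ->; apply: perm_big; apply: uniq_perm; rewrite ?fset_uniq ?iota_uniq//.
  by move=> j; rewrite !inE/= /index_iota subn0.
have mC := mXB n.+1 B mB; set C := X n.+1 @^-1` B in mC *.
have PC : P C \is a fin_num by exact: fin_num_measure.
pose m1 : {measure set T -> \bar R} := mrestr P mC.
pose m2 : {measure set T -> \bar R} :=
  mscale (NngNum (fine_ge0 (measure_ge0 P C))) P.
suff : m1 A = m2 A by rewrite /m1 /m2/= /mrestr /mscale/= fineK// muleC.
apply: (g_sigma_algebra_measure_unique H Hm (fun=> setT)) => //.
- by apply/seteqP; split=> // x _; exists 0%N.
- move=> _ [D mD ->]; rewrite /m1 /m2/= /mrestr /mscale/= fineK// muleC.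
  (* Placing [B] at index [n.+1] turns the intersection with [C] into a cylinder over the indices up
     to [n.+1]. *)
  pose D' j := if j == n.+1 then B else D j.
  have mD' j : measurable (D' j) by rewrite /D'; case: ifP.
  have := prodE D' n.+2 mD'; rewrite big_nat_recr//= [D' n.+1]/D' eqxx -/C.
  rewrite (eq_big_nat _ _ (F2 := fun j => P (X j @^-1` D j))); last first.
    by move=> j /andP[_ jn]; rewrite /D' ltn_eqF.
  rewrite -prodE// => <-; congr (P _); apply/seteqP; split.
    move=> x [xD xC] j /=; rewrite ltnS leq_eqVlt => /orP[/eqP->|jn].
      by rewrite /D' eqxx.
    by rewrite /D' ltn_eqF//; exact: xD.
  move=> x xD'; split=> [j /= jn|].
    by have := xD' j (ltnW jn); rewrite /D' ltn_eqF.
  by have := xD' n.+1 (ltnSn _); rewrite /D' eqxx.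
- by move=> k; rewrite /m1/= /mrestr setTI ltey_eq PC.
(* It remains to see that [H] generates the history: an event about a single [X i] is the cylinder
   with [setT] at all other indices. *)
move: A hA; apply: sub_smallest2r; first exact: smallest_sigma_algebra.
move=> A; rewrite -bigcup_mkord_ord => -[i /= iin [D mD <-]].
exists (fun j => if j == i then D else setT).
  by move=> j; case: ifP.
rewrite setTI inordK//; apply/seteqP; split=> x.
  by move=> xD j _ /=; case: eqP => // ->.
by move=> /(_ i iin)/=; rewrite eqxx.
Qed.

End independence.

(** * The martingale and the two submartingales *)

Section running_maximum.
Context {d : measure_display} {T : measurableType d} {R : realType}.
Variables (P : probability T R) (D : nat -> T -> R).
Hypothesis mD : forall n, measurable_fun setT (D n).

(** The common shape of [Mseq] and [Useq]; starting from 0 makes it nonnegative whatever the sign of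
    [D]. *)
Let M n w := \big[Num.max/0]_(j < n.+1) D j w.

Let M_ge0 n w : 0 <= M n w.
Proof. exact: bigmax_ge_id. Qed.

Let MS n w : M n.+1 w = Num.max (M n w) (D n.+1 w).
Proof.
apply/le_anti/andP; split.
  apply: bigmax_le => [|j _]; first by rewrite le_max M_ge0.
  have [jn|nj] := ltnP j n.+1.
    by rewrite le_max (le_bigmax _ (fun i : 'I_n.+1 => D i w) (Ordinal jn)).
  have -> : nat_of_ord j = n.+1 by apply/eqP; rewrite eqn_leq nj -ltnS ltn_ord.
  by rewrite le_max lexx orbT.
rewrite ge_max (le_bigmax _ (fun i : 'I_n.+2 => D i w) ord_max) andbT.
apply: bigmax_le => [|j _]; first exact: M_ge0.
exact: (le_bigmax _ (fun i : 'I_n.+2 => D i w) (widen_ord (leqnSn _) j)).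
Qed.

Let M0 w : M 0 w = Num.max 0 (D 0 w).
Proof. by rewrite /M big_ord_recl big_ord0 maxC. Qed.

Lemma measurable_runmax n : measurable_fun setT (M n).
Proof.
elim: n => [|n IHn].
  rewrite (_ : M 0 = cst 0 \max D 0); last by apply/funext => w; rewrite M0.
  by apply: measurable_maxr => //; exact: measurable_cst.
rewrite (_ : M n.+1 = M n \max D n.+1); last by apply/funext => w; rewrite MS.
exact: measurable_maxr.
Qed.

Lemma ge0_submartingale_runmax : ge0_submartingale P M.
Proof.
split=> //; first exact: measurable_runmax.
apply: nondecreasing_submartingale_ineq => //; first exact: measurable_runmax.
by move=> n w; rewrite MS le_max lexx.
Qed.

Lemma integrable_runmax n : (forall k, P.-integrable setT (EFin \o D k)) ->
  P.-integrable setT (EFin \o M n).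
Proof.
move=> iD; have normr_max (a b : R) : `|Num.max a b| <= `|a| + `|b|.
  by rewrite /Num.max; case: ifP => _; rewrite ?lerDl ?lerDr.
have step (f g : T -> R) : measurable_fun setT f -> measurable_fun setT g ->
    P.-integrable setT (EFin \o f) -> P.-integrable setT (EFin \o g) ->
    P.-integrable setT (EFin \o (f \max g)).
  move=> mf mg intf intg.
  have intfg := integrableD measurableT (integrable_abse intf) (integrable_abse intg).
  apply: (le_integrable measurableT _ _ intfg).
    by apply/measurable_EFinP; exact: measurable_maxr.
  move=> w _ /=; rewrite lee_fin; apply: (le_trans (normr_max _ _)).
  exact: ler_norm.
elim: n => [|n IHn].
  rewrite (_ : M 0 = cst 0 \max D 0); last by apply/funext => w; rewrite M0.
  by apply: step => //; exact: integrable0.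
rewrite (_ : M n.+1 = M n \max D n.+1); last by apply/funext => w; rewrite MS.
by apply: step => //; exact: measurable_runmax.
Qed.

End running_maximum.

(** * The random products: measurability, conditional means, integrability *)

Section random_product.
Context {R : realType} {m : nat}.

Section measurability_and_positivity.
Context {d : measure_display} {T : measurableType d}.
Variable X : nat -> T -> 'M[R]_m.
Hypothesis posX : forall n w, posdefmx (X n w).

Lemma posdef_Sseq n w : posdefmx (Sseq X n w).
Proof. by elim: n => [|n IHn] /=; [exact: posX|exact: posdef_conj]. Qed.

Lemma measurable_sqrtmx_posdef (A : T -> 'M[R]_m) :
  (forall w, posdefmx (A w)) -> measurable_fun setT A ->
  measurable_fun setT (fun w => sqrtmx (A w)).
Proof.
move=> posA mA; under eq_fun do rewrite -sqrtmx_limE//.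
exact: measurableT_comp measurable_sqrtmx_lim mA.
Qed.

Lemma measurable_dR1_posdef (A : T -> 'M[R]_m) :
  (forall w, posdefmx (A w)) -> measurable_fun setT A ->
  measurable_fun setT (fun w => dR 1%:M (A w)).
Proof.
move=> posA mA; under eq_fun do rewrite -dR1_limE//.
exact: measurableT_comp measurable_dR1_lim mA.
Qed.

(** Only the indices up to [n] are constrained, so that the lemma also applies on the sigma-algebra
    generated by these matrices alone. *)
Lemma measurable_Sseq n : (forall k, (k <= n)%N -> measurable_fun setT (X k)) ->
  measurable_fun setT (Sseq X n).
Proof.
elim: n => [|n IHn] mX; first exact: mX.
have mS : measurable_fun setT (fun w => sqrtmx (Sseq X n w)).
  apply: measurable_sqrtmx_posdef; first exact: posdef_Sseq.
  by apply: IHn => k kn; apply: mX; exact: leqW.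
by apply: measurable_mulmx => //; apply: measurable_mulmx => //; exact: mX.
Qed.

End measurability_and_positivity.

(** By symmetry of the root, [A i i] is the sum of the squares of the entries in row [i] of
    [sqrtmx A]. *)
Lemma sqrtmx_entry_sqr (A : 'M[R]_m) i k : posdefmx A ->
  sqrtmx A i k ^+ 2 <= A i i.
Proof.
move=> posA; rewrite -{2}(sqrtmx_sqr posA) mxE (bigD1 k)//=.
have symA j : sqrtmx A j i = sqrtmx A i j by rewrite -[in LHS]tr_sqrtmx// mxE.
rewrite symA -expr2 lerDl sumr_ge0// => j _; by rewrite symA -expr2 sqr_ge0.
Qed.

Lemma sqrtmx_entries_le (A : 'M[R]_m) i k l j : posdefmx A ->
  `|sqrtmx A i k * sqrtmx A l j| <= A i i + A j j.
Proof.
move=> posA; have ik := sqrtmx_entry_sqr i k posA.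
have jl := sqrtmx_entry_sqr j l posA.
have -> : sqrtmx A l j = sqrtmx A j l by rewrite -[in LHS]tr_sqrtmx// mxE.
move: (sqrtmx A i k) (sqrtmx A j l) ik jl => x y x2 y2.
rewrite normrM; apply: le_trans (lerD x2 y2).
rewrite -(real_normK (num_real x)) -(real_normK (num_real y)).
have := sqr_ge0 (`|x| - `|y|); have := normr_ge0 x; have := normr_ge0 y.
by nra.
Qed.

Section expectations.
Context {d : measure_display} {T : measurableType d}.
Variables (P : probability T R) (X : nat -> T -> 'M[R]_m).
Hypotheses (mX : forall n, measurable_fun setT (X n))
  (posX : forall n w, posdefmx (X n w)).

Let mS n : measurable_fun setT (Sseq X n).
Proof. by apply: measurable_Sseq. Qed.

Local Notation gen Y n :=
  (\big[setU/set0]_(i < n.+1) preimage_set_system setT (Y i) measurable).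

(** Identities tested on the events of the history of [X], where independence is available, thus
    hold on those of [Sseq X]. *)
Lemma history_Sseq n : history (Sseq X) n `<=` history X n.
Proof.
apply: smallest_sub; first exact: smallest_sigma_algebra.
move=> A; rewrite -bigcup_mkord_ord => -[i /= iin [D mD <-]].
have mSi : measurable_fun [set: g_sigma_algebraType (gen X n)] (Sseq X i).
  apply: (@measurable_Sseq _ (g_sigma_algebraType (gen X n)) X) => //.
  by move=> k ki; apply: measurable_history; exact: leq_trans ki iin.
by rewrite inordK//; exact: mSi.
Qed.

Hypotheses (indX : mutually_independent P X)
  (meanX : forall n, has_mean_mx P (X n) 1%:M).

(** The entry expands into terms [f k l w * X n.+1 w k l] whose coefficient is known from the
    history. Independence replaces [X n.+1 w k l] by its mean, an entry of the identity matrix. *)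
Lemma integral_Sseq_succ n A i j : history X n A ->
  (forall i, P.-integrable setT (fun w => (Sseq X n w i i)%:E)) ->
  P.-integrable setT (fun w => (\1_A w * Sseq X n.+1 w i j)%:E) /\
  (\int[P]_w (\1_A w * Sseq X n.+1 w i j)%:E =
   \int[P]_w (\1_A w * Sseq X n w i j)%:E)%E.
Proof.
move=> hA iS; pose s w := sqrtmx (Sseq X n w).
have GX := history_gen_measurable (n := n) mX.
have mA := g_sigma_measurable GX hA.
pose f k l w := \1_A w * (s w i k * s w l j) : R.
have mf k l : measurable_fun [set: g_sigma_algebraType (gen X n)] (f k l).
  apply: measurable_funM; first exact: measurable_indic.
  have : measurable_fun [set: g_sigma_algebraType (gen X n)] s.
    apply: (@measurable_sqrtmx_posdef _ (g_sigma_algebraType (gen X n))).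
      exact: posdef_Sseq.
    apply: (@measurable_Sseq _ (g_sigma_algebraType (gen X n)) X) => //.
    by move=> p pn; apply: measurable_history.
  by move=> /measurable_mxP ms; apply: measurable_funM; exact: ms.
have intf k l : P.-integrable setT (EFin \o f k l).
  apply: (le_integrable measurableT _ _ (integrableD measurableT (iS i) (iS j))).
    by apply/measurable_EFinP; exact: (measurable_fun_g_sigma GX (mf k l)).
  move=> w _ /=; rewrite lee_fin [leRHS]ger0_norm; last first.
    exact: le_trans (sqrtmx_entries_le i i j j (posdef_Sseq posX n w)).
  rewrite /f normrM; apply: le_trans (sqrtmx_entries_le i k l j (posdef_Sseq posX n w)).
  by rewrite ler_piMl// indicE; case: (_ \in _); rewrite ?normr1 ?normr0.
have fX k l : P.-integrable setT (fun w => (f k l w * X n.+1 w k l)%:E) /\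
    (\int[P]_w (f k l w * X n.+1 w k l)%:E =
     \int[P]_w (f k l w)%:E * (1%:M k l : R)%:E)%E.
  have [iXkl EXkl] := meanX n.+1 k l.
  have mXkl : measurable_fun setT (fun w => X n.+1 w k l).
    by have /measurable_mxP := mX n.+1; exact.
  have -> : (1%:M k l : R)%:E = (\int[P]_w (X n.+1 w k l)%:E)%E.
    by rewrite -EXkl unlock.
  apply: (independent_integralM GX (mf k l) mXkl (intf k l) iXkl) => C B hC mB.
  have mB' : measurable ((fun M : 'M[R]_m => M k l) @^-1` B).
    by rewrite -[_ @^-1` _]setTI; exact: measurable_coord.
  exact: (history_independent mX indX hC mB').
have SE w : \1_A w * Sseq X n.+1 w i j = \sum_k \sum_l f k l w * X n.+1 w k l.
  rewrite /= mxE mulr_sumr exchange_big/=; apply: eq_bigr => l _.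
  rewrite mxE mulr_suml mulr_sumr; apply: eq_bigr => k _.
  by rewrite /f /s; ring.
have SEE w : (\1_A w * Sseq X n.+1 w i j)%:E =
    (\sum_k \sum_l (f k l w * X n.+1 w k l)%:E)%E.
  by rewrite SE -sumEFin; apply: eq_bigr => k _; rewrite sumEFin.
have iSk k : P.-integrable setT (fun w => \sum_l (f k l w * X n.+1 w k l)%:E)%E.
  by apply: integrable_sum => // l _; exact: (fX k l).1.
split.
  by under eq_fun do rewrite SEE; apply: integrable_sum.
under eq_integral do rewrite SEE.
rewrite integral_sum//.
(* Only [l = k] survives; the remaining sum over [k] is an entry of the square of the root, that is,
   of [Sseq X n]. *)
transitivity (\sum_k \int[P]_w (f k k w)%:E)%E.
  apply: eq_bigr => k _; rewrite integral_sum//; last by move=> l; exact: (fX k l).1.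
  rewrite (bigD1 k)//= big1 ?adde0; last first.
    by move=> l lk; rewrite (fX k l).2 mxE eq_sym (negPf lk) mule0.
  by rewrite (fX k k).2 mxE eqxx mule1.
transitivity (\int[P]_w \sum_k (f k k w)%:E)%E.
  by rewrite integral_sum// => k; exact: (intf k k).
apply: eq_integral => w _.
rewrite sumEFin -mulr_sumr; congr (_ * _)%:E.
by rewrite -(sqrtmx_sqr (posdef_Sseq posX n w)) mxE.
Qed.

(** Integrability of the diagonal entries passes to all entries at the next index, by
    [integral_Sseq_succ] on the whole space. *)
Lemma integrable_Sseq n i j : P.-integrable setT (fun w => (Sseq X n w i j)%:E).
Proof.
elim: n i j => [|n IHn] i j; first exact: (meanX 0 i j).1.
have hT : history X n setT.
  exact: (@measurableT _ (g_sigma_algebraType (gen X n))).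
have [+ _] := integral_Sseq_succ i j hT (fun k => IHn k k).
by under eq_fun do rewrite indicT mul1r.
Qed.

Lemma martingale_Sseq : martingale_mx P (Sseq X).
Proof.
split=> [n w||n|n].
- by have [] := posdef_Sseq posX n w.
- exact: mS.
- have intS : P.-integrable setT (fun w => \sum_i \sum_j `|(Sseq X n w i j)%:E|)%E.
    apply: integrable_sum => // i _; apply: integrable_sum => // j _.
    exact/integrable_abse/integrable_Sseq.
  apply: (le_integrable measurableT _ _ intS).
    by apply/measurable_EFinP; exact: (measurableT_comp (@measurable_specnorm R m) (mS n)).
  move=> w _; under eq_bigr do rewrite sumEFin.
  rewrite sumEFin /= lee_fin ger0_norm ?specnorm_ge0//.
  exact: le_trans (specnorm_le _) (ler_norm _).
- exists (Sseq X n); last exact: aeW.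
  move=> i j; split.
    move=> _ [B mB <-].
    have := measurable_history (Y := Sseq X) (leqnn n).
    by move=> /measurable_mxP/(_ i j)/measurable_EFinP/(_ measurableT _ mB).
  move=> A /history_Sseq hA.
  have restrE (f : T -> R) : (\int[P]_(w in A) (f w)%:E =
      \int[P]_w (\1_A w * f w)%:E)%E.
    rewrite integral_mkcond; apply: eq_integral => w _.
    by rewrite patchE indicE; case: ifP; rewrite ?mul1r ?mul0r.
  rewrite !restrE; apply/esym.
  by have [] := integral_Sseq_succ i j hA (fun k => integrable_Sseq n k k).
Qed.

Lemma integrable_dR1_Sseq n :
  (forall k, P.-integrable setT (fun w => (dR 1%:M (X k w))%:E)) ->
  P.-integrable setT (fun w => (dR 1%:M (Sseq X n w))%:E).
Proof.
move=> iX; elim: n => [|n IHn]; first exact: iX.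
have int_sum := integrableZl measurableT m%:R (integrableD measurableT IHn (iX n.+1)).
apply: (le_integrable measurableT _ _ int_sum).
  apply/measurable_EFinP; apply: measurable_dR1_posdef => //.
  exact: posdef_Sseq.
move=> w _; rewrite /= lee_fin ger0_norm ?dR1_ge0//.
by apply: le_trans (ler_norm _); apply: dR1_conj => //; exact: posdef_Sseq.
Qed.

End expectations.

Lemma integrable_same_distribution d (T : measurableType d) (P : probability T R)
    d' (E : measurableType d') (X Y : {RV P >-> E}) (h : E -> R) :
  measurable_fun setT h -> same_distribution P X Y ->
  P.-integrable setT (fun w => (h (Y w))%:E) ->
  P.-integrable setT (fun w => (h (X w))%:E).
Proof.
move=> mh sXY /integrableP[_ iY].
have mhE : measurable_fun setT (EFin \o h) by exact/measurable_EFinP.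
apply/integrableP; split; first exact: measurableT_comp mhE _.
have lawE (Z : {RV P >-> E}) : (\int[P]_w `|(h (Z w))%:E| =
    \int[distribution P Z]_z `|(h z)%:E|)%E.
  rewrite /distribution ge0_integral_pushforward//.
  exact: measurableT_comp mhE.
rewrite lawE; rewrite lawE in iY; apply: le_lt_trans iY.
by rewrite (@eq_measure_integral _ _ _ _ (distribution P Y))// => A mA _; exact: sXY.
Qed.

End random_product.

Theorem propositionA1 (d : measure_display) (T : measurableType d)
    (R : realType) (P : probability T R) (m : nat)
    (X : nat -> {RV P >-> 'M[R]_m}) :
  (forall n w, posdefmx (X n w)) ->
  (forall n, orthogonally_invariant P (X n)) ->
  mutually_independent P X ->
  (forall n, same_distribution P (X n) (X 0%N)) ->
  (forall n, has_mean_mx P (X n) 1%:M) ->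
  [/\ martingale_mx P (Sseq X),
      ge0_submartingale P (Mseq X),
      ge0_submartingale P (Useq X) &
      P.-integrable setT (fun w => (dR 1%:M (X 0%N w))%:E) ->
      submartingale P (Mseq X) /\ submartingale P (Useq X)].
Proof.
move=> posX _ indX sameX meanX.
have mX n : measurable_fun setT (X n) by exact: measurable_funPT.
have mDX n : measurable_fun setT (fun w => dR 1%:M (X n w)).
  exact: measurable_dR1_posdef.
have mDS n : measurable_fun setT (fun w => dR 1%:M (Sseq X n w)).
  apply: measurable_dR1_posdef; first exact: posdef_Sseq.
  by apply: measurable_Sseq.
have subM := ge0_submartingale_runmax P mDX.
have subU := ge0_submartingale_runmax P mDS.
split.
- exact: (martingale_Sseq mX posX indX meanX).
- exact: subM.
- exact: subU.
move=> iX0.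
have iX n : P.-integrable setT (fun w => (dR 1%:M (X n w))%:E).
  (* Transfer between equal laws needs a function measurable on the whole matrix space, so [dR1_lim]
     stands in for the distance. *)
  under eq_fun do rewrite -dR1_limE//.
  apply: (integrable_same_distribution measurable_dR1_lim (sameX n)).
  by under eq_fun do rewrite dR1_limE//.
split; split.
- by move=> n; exact: (integrable_runmax mDX n iX).
- by case: subM.
- move=> n; apply: (integrable_runmax mDS n) => k.
  exact: (integrable_dR1_Sseq mX posX k iX).
- by case: subU.
Qed.
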